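(* Let $\mathbb K$ be a field, $\triangle$ a simplicial complex on a finite vertex set $V$, $M_\triangle$ its simplicial binoid and $\mathbb K[\triangle]=\mathbb K[M_\triangle]$ its Stanley-Reisner ring. In the combinatorial topology of $\operatorname{Spec}^\bullet\mathbb K[M_\triangle]$ the sheaf of units splits as $$\mathcal O^*_{\mathbb K[\triangle]}=i_*\mathcal O^*_{M_\triangle}\oplus\mathbb K^*,$$ where $\mathbb K^*$ is the constant sheaf and $i:\operatorname{Spec}M_\triangle\to\operatorname{Spec}\mathbb K[M_\triangle]$ is the map $\mathfrak p\mapsto\mathbb K[\mathfrak p]$.
   Context: A binoid $(M,+,0,\infty)$ is a commutative monoid with an absorbing element $\infty$; $M^*$ is its group of units. An ideal is a subset $I\ni\infty$ with $M+I\subseteq I$; it is prime if $I\ne M$ and $a+b\in I$ implies $a\in I$ or $b\in I$. $\operatorname{Spec}M$ is the set of prime ideals with the topology having basis $D(f)=\{\mathfrak p\mid f\notin\mathfrak p\}$. The structure sheaf $\mathcal O_M$ is the sheaf of binoids associated to $D(f)\mapsto M_f$ (localization) and $\mathcal O^*_M(U)=(\mathcal O_M(U))^*$. $\mathbb K[M]$ is the $\mathbb K$-algebra with basis $T^\mu$, $\mu\in M\setminus\{\infty\}$, $T^\mu T^\nu=T^{\mu+\nu}$, $T^\infty=0$. For an ideal $I\subseteq M$, $\mathbb K[I]$ is the ideal spanned by $T^\mu$, $\mu\in I$; such ideals are called combinatorial. The combinatorial topology on $\operatorname{Spec}\mathbb K[M]$ has as open sets the sets $D(\mathfrak A)$ (complement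 of $V(\mathfrak A)$) with $\mathfrak A$ a combinatorial ideal; sheaves on the Zariski topology are restricted to it. $\operatorname{Spec}^\bullet\mathbb K[M]=\operatorname{Spec}\mathbb K[M]\setminus\{\mathbb K[M_+]\}$ with $M_+=M\setminus M^*$. A simplicial complex $\triangle$ on $V$ is a set of subsets of $V$ closed under taking subsets and containing all singletons. $M_\triangle$ is the commutative binoid generated by $x_v$, $v\in V$, with relations $\sum_{v\in H}x_v=\infty$ for all $H\subseteq V$, $H\notin\triangle$; thus $\mathbb K[M_\triangle]=\mathbb K[X_v\mid v\in V]/(\prod_{v\in H}X_v\mid H\notin\triangle)=\mathbb K[\triangle]$. For this binoid $\mathbb K[\mathfrak p]$ is prime for each prime $\mathfrak p$, and $i$ is continuous. $\mathcal O^*_{\mathbb K[\triangle]}$ is the sheaf of units of the structure sheaf of $\operatorname{Spec}\mathbb K[\triangle]$. *)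

(* Defs.v *)
From HB Require Import structures.
From mathcomp Require Import all_boot all_order all_algebra finmap.
From mathcomp Require Import generic_quotient.
From mathcomp Require Import mathcomp_extra boolp classical_sets functions.
From mathcomp Require Import topology_structure.
From mathcomp Require Import monalg.

Set Implicit Arguments.
Unset Strict Implicit.
Unset Printing Implicit Defensive.

Import GRing.Theory.
Local Open Scope quotient_scope.
Local Open Scope ring_scope.
Local Open Scope classical_set_scope.

(* Commutative monoids are [nmodType]s and are written additively throughout;
   for the multiplicative monoid of a ring see [mulmon]. *)

Section Units.
Variable A : nmodType.

Definition is_unit (x : A) : Prop := exists y, x + y = 0.

Definition units := {x : A | `[< is_unit x >]}.

HB.instance Definition _ := Choice.on units.

Lemma unitsP (x : units) : is_unit (val x).
Proof. exact/asboolP/(valP x). Qed.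

Definition mk_unit (x : A) (h : is_unit x) : units := exist _ x (asboolT h).

Lemma is_unit0 : is_unit 0.
Proof. by exists 0; rewrite addr0. Qed.

Lemma is_unitD x y : is_unit x -> is_unit y -> is_unit (x + y).
Proof.
by move=> [x' hx] [y' hy]; exists (x' + y'); rewrite addrACA hx hy addr0.
Qed.

Lemma unit_opp_subproof (x : units) : is_unit (sval (cid (unitsP x))).
Proof. by case: cid => y hy /=; exists (val x); rewrite addrC. Qed.

Definition units_zero := mk_unit is_unit0.
Definition units_add (x y : units) := mk_unit (is_unitD (unitsP x) (unitsP y)).
Definition units_opp (x : units) := mk_unit (unit_opp_subproof x).

Lemma units_addA : associative units_add.
Proof. by move=> x y z; apply/val_inj; rewrite /= addrA. Qed.
Lemma units_addC : commutative units_add.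
Proof. by move=> x y; apply/val_inj; rewrite /= addrC. Qed.
Lemma units_add0 : left_id units_zero units_add.
Proof. by move=> x; apply/val_inj; rewrite /= add0r. Qed.
Lemma units_addN : left_inverse units_zero units_opp units_add.
Proof. by move=> x; apply/val_inj => /=; case: cid => y hy /=; rewrite addrC. Qed.

HB.instance Definition _ := GRing.isZmodule.Build units
  units_addA units_addC units_add0 units_addN.

End Units.

Section UnitsMap.
Variables (A B : nmodType) (f : {additive A -> B}).

Lemma units_map_subproof (x : units A) : is_unit (f (val x)).
Proof. by have [y hy] := unitsP x; exists (f y); rewrite -raddfD hy raddf0. Qed.

Definition units_map (x : units A) : units B := mk_unit (units_map_subproof x).

Lemma units_map_morphism : nmod_morphism units_map.
Proof.
by split=> [|x y]; apply/val_inj; rewrite /= ?raddf0 ?raddfD.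
Qed.

HB.instance Definition _ :=
  GRing.isNmodMorphism.Build (units A) (units B) units_map units_map_morphism.

Lemma units_mapN x : units_map (- x) = - units_map x.
Proof. exact: (raddfN units_map). Qed.

End UnitsMap.

(** The multiplicative monoid of a ring, written additively: in [mulmon R] the
    sum of [MulMon a] and [MulMon b] is [MulMon (a * b)], and zero is
    [MulMon 1]. *)
Record mulmon (R : comPzRingType) := MulMon { of_mulmon : R }.

Section MulMon.
Variable R : comPzRingType.

HB.instance Definition _ := [isNew for @of_mulmon R].
HB.instance Definition _ := [Choice of mulmon R by <:].

Definition mulmon_zero : mulmon R := MulMon 1.
Definition mulmon_add (a b : mulmon R) : mulmon R :=
  MulMon (of_mulmon a * of_mulmon b).

Lemma mulmon_addA : associative mulmon_add.
Proof. by move=> a b c; rewrite /mulmon_add /= mulrA. Qed.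
Lemma mulmon_addC : commutative mulmon_add.
Proof. by move=> a b; rewrite /mulmon_add mulrC. Qed.
Lemma mulmon_add0 : left_id mulmon_zero mulmon_add.
Proof. by move=> [a]; rewrite /mulmon_add /= mul1r. Qed.

HB.instance Definition _ :=
  GRing.isNmodule.Build (mulmon R) mulmon_addA mulmon_addC mulmon_add0.

End MulMon.

Record submonoid (A : nmodType) := Submonoid {
  in_submon :> A -> Prop;
  submon0 : in_submon 0;
  submonD : forall a b, in_submon a -> in_submon b -> in_submon (a + b)
}.

Section Localization.
Variables (A : nmodType) (S : submonoid A).

Definition denom := {s : A | `[< S s >]}.
HB.instance Definition _ := Choice.on denom.

Lemma denomP (s : denom) : S (val s).
Proof. exact/asboolP/(valP s). Qed.

Definition mk_denom (s : A) (h : S s) : denom := exist _ s (asboolT h).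

Definition frac_rel (x y : A * denom) : bool :=
  `[< exists2 u, S u & u + (x.1 + val y.2) = u + (y.1 + val x.2) >].

Lemma frac_rel_refl : reflexive frac_rel.
Proof. by move=> x; apply/asboolP; exists 0 => //; exact: submon0. Qed.

Lemma frac_rel_sym : symmetric frac_rel.
Proof.
by move=> x y; apply/asboolP/asboolP => -[u Su e]; exists u.
Qed.

Lemma frac_rel_trans : transitive frac_rel.
Proof.
move=> y x z /asboolP[u Su e] /asboolP[v Sv f]; apply/asboolP.
exists (u + v + val y.2); first by do 2?[apply: submonD] => //; exact: denomP.
rewrite !addrA in e f *.
rewrite [LHS](ACl (1*4*3*2*5)) /= e.
rewrite [LHS](ACl (4*2*5*1*3)) /= f.
by rewrite [LHS](ACl (4*1*3*2*5)).
Qed.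

Canonical frac_equiv := EquivRel frac_rel frac_rel_refl frac_rel_sym
  frac_rel_trans.

(** [loc] is the localization; [frac a hs] is the class of the fraction with
    numerator [a] and denominator [s], where [hs : S s]. *)
Definition loc := {eq_quot frac_equiv}.
HB.instance Definition _ := Choice.on loc.
HB.instance Definition _ := Quotient.on loc.
HB.instance Definition _ := EqQuotient.on loc.

Definition frac (a s : A) (hs : S s) : loc := \pi_loc (a, mk_denom hs).

Lemma fracE a s hs b t ht :
  @frac a s hs = @frac b t ht <-> exists2 u, S u & u + (a + t) = u + (b + s).
Proof.
split=> [/eqmodP /asboolP|h]; first by [].
by apply/eqmodP/asboolP.
Qed.

Lemma frac_surj (x : loc) : exists a s hs, x = @frac a s hs.
Proof.
case: (repr x) (reprK x) => a s <-; exists a, (val s), (denomP s).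
by congr (\pi_loc (_, _)); apply/val_inj.
Qed.

Definition loc_zero : loc := frac 0 (submon0 S).

Definition loc_add (x y : loc) : loc :=
  frac ((repr x).1 + (repr y).1)
       (submonD (denomP (repr x).2) (denomP (repr y).2)).

Lemma frac_repr (x : loc) : frac (repr x).1 (denomP (repr x).2) = x.
Proof.
rewrite -[RHS]reprK; case: (repr x) => a s /=.
by congr (\pi_loc (_, _)); apply/val_inj.
Qed.

Lemma loc_addE a s hs b t ht :
  loc_add (@frac a s hs) (@frac b t ht) = frac (a + b) (submonD hs ht).
Proof.
have /fracE[u Su e] := frac_repr (@frac a s hs).
have /fracE[v Sv f] := frac_repr (@frac b t ht).
apply/fracE; exists (u + v); first exact: submonD.
move: (repr _) (repr _) e f => [a' s'] [b' t'] /= e f.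
rewrite !addrA in e f *.
rewrite [LHS](ACl (1*3*5*2*4*6)) /= e.
by rewrite [LHS](ACl (4*5*6*1*2*3)) /= f [LHS](ACl (4*1*5*2*6*3)).
Qed.

Lemma frac_irr a b s t hs ht : a = b -> s = t -> @frac a s hs = @frac b t ht.
Proof. by move=> -> st; apply/fracE; exists 0; [exact: submon0|rewrite st]. Qed.

Lemma loc_addA : associative loc_add.
Proof.
move=> x y z; have [a [s [hs ->]]] := frac_surj x.
have [b [t [ht ->]]] := frac_surj y; have [c [u [hu ->]]] := frac_surj z.
by rewrite !loc_addE; apply: frac_irr; rewrite addrA.
Qed.
Lemma loc_addC : commutative loc_add.
Proof.
move=> x y; have [a [s [hs ->]]] := frac_surj x.
have [b [t [ht ->]]] := frac_surj y.
by rewrite !loc_addE; apply: frac_irr; rewrite addrC.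
Qed.
Lemma loc_add0 : left_id loc_zero loc_add.
Proof.
move=> x; have [a [s [hs ->]]] := frac_surj x.
by rewrite loc_addE; apply: frac_irr; rewrite add0r.
Qed.

HB.instance Definition _ := GRing.isNmodule.Build loc loc_addA loc_addC loc_add0.

Lemma fracD a s hs b t ht :
  @frac a s hs + @frac b t ht = frac (a + b) (submonD hs ht).
Proof. exact: loc_addE. Qed.

End Localization.

Record opens (X : topologicalType) := Opens {
  in_opens :> set X;
  opens_open : open in_opens
}.

(** Morphisms between abelian groups for the underlying monoid structures are
    the group homomorphisms, so a morphism or an isomorphism between sheaves of
    abelian groups is the same thing in this category. *)
Record sheaf (X : topologicalType) := Sheaf {
  sections :> opens X -> nmodType;
  restr : forall U W : opens X, W `<=` U -> {additive sections U -> sections W};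
  restr_id : forall (U : opens X) (h : U `<=` U) (s : sections U),
    restr h s = s;
  restr_comp : forall (U V W : opens X) (hVU : V `<=` U) (hWV : W `<=` V)
    (hWU : W `<=` U) (s : sections U), restr hWV (restr hVU s) = restr hWU s;
  sheaf_separated : forall (U : opens X) (I : Type) (W : I -> opens X)
    (hW : forall i, W i `<=` U), U `<=` \bigcup_i W i ->
    forall s t : sections U,
    (forall i, restr (hW i) s = restr (hW i) t) -> s = t;
  sheaf_glue : forall (U : opens X) (I : Type) (W : I -> opens X)
    (hW : forall i, W i `<=` U), U `<=` \bigcup_i W i ->
    forall s : forall i, sections (W i),
    (forall i j (N : opens X) (hi : N `<=` W i) (hj : N `<=` W j),
       restr hi (s i) = restr hj (s j)) ->
    exists t : sections U, forall i, restr (hW i) t = s i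
}.

Arguments restr {X} F {U W} h : rename.
Arguments restr_id {X} F {U} h _ : rename.
Arguments restr_comp {X} F {U V W} hVU hWV hWU _ : rename.
Arguments sheaf_separated {X} F {U I W} hW _ _ _ _ : rename.
Arguments sheaf_glue {X} F {U I W} hW _ _ _ : rename.

(** A morphism between the restrictions of [F] and [G] to the open set [Y]. *)
Record sheaf_hom_on (X : topologicalType) (Y : opens X) (F G : sheaf X) :=
  SheafHomOn {
  sheaf_app : forall U : opens X, U `<=` Y -> {additive F U -> G U};
  sheaf_natural : forall (U W : opens X) (hU : U `<=` Y) (hW : W `<=` Y)
    (hWU : W `<=` U) (s : F U),
    sheaf_app hW (restr F hWU s) = restr G hWU (sheaf_app hU s)
}.

Definition is_sheaf_iso (X : topologicalType) (Y : opens X) (F G : sheaf X)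
    (phi : sheaf_hom_on Y F G) : Prop :=
  forall (U : opens X) (hU : U `<=` Y), bijective (sheaf_app phi hU).

Section UnitsSheaf.
Variables (X : topologicalType) (F : sheaf X).

Let ures (U W : opens X) (h : W `<=` U) :
  {additive units (F U) -> units (F W)} := units_map (restr F h).

Let ures_id (U : opens X) (h : U `<=` U) s : ures h s = s.
Proof. by apply/val_inj; rewrite /= restr_id. Qed.

Let ures_comp (U V W : opens X) (hVU : V `<=` U) (hWV : W `<=` V)
  (hWU : W `<=` U) s : ures hWV (ures hVU s) = ures hWU s.
Proof. by apply/val_inj; rewrite /= (restr_comp F _ _ hWU). Qed.

Let ures_sep (U : opens X) (I : Type) (W : I -> opens X)
  (hW : forall i, W i `<=` U) : U `<=` \bigcup_i W i ->
  forall s t, (forall i, ures (hW i) s = ures (hW i) t) -> s = t.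
Proof.
move=> cov s t st; apply/val_inj/(sheaf_separated F hW cov) => i.
exact: (congr1 val (st i)).
Qed.

Let ures_glue (U : opens X) (I : Type) (W : I -> opens X)
  (hW : forall i, W i `<=` U) : U `<=` \bigcup_i W i ->
  forall s : forall i, units (F (W i)),
  (forall i j (N : opens X) (hi : N `<=` W i) (hj : N `<=` W j),
     ures hi (s i) = ures hj (s j)) ->
  exists t, forall i, ures (hW i) t = s i.
Proof.
move=> cov s ss.
have [t ht] := sheaf_glue F hW cov _ (fun i j N hi hj => congr1 val (ss i j N hi hj)).
have ssN i j (N : opens X) (hi : N `<=` W i) (hj : N `<=` W j) :
    restr F hi (val (- s i)) = restr F hj (val (- s j)).
  suff : ures hi (- s i) = ures hj (- s j) by move/(congr1 val).
  apply: (etrans (units_mapN _ _)); apply: (etrans _ (esym (units_mapN _ _))).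
  by apply: (congr1 (fun x : units (F N) => - x)); exact: ss.
have [t' ht'] := sheaf_glue F hW cov _ ssN.
have tt' : t + t' = 0.
  apply: (sheaf_separated F hW cov) => i; rewrite raddfD raddf0 ht ht'.
  exact: (congr1 val (addrN (s i))).
have ut : is_unit t by exists t'.
by exists (mk_unit ut) => i; apply/val_inj; rewrite /= ht.
Qed.

Definition units_sheaf : sheaf X :=
  Sheaf ures_id ures_comp ures_sep ures_glue.

End UnitsSheaf.

Section DirectSum.
Variables (X : topologicalType) (F G : sheaf X).

Definition dsum_app (U W : opens X) (h : W `<=` U) (s : (F U * G U)%type) :
  (F W * G W)%type := (restr F h s.1, restr G h s.2).

Lemma dsum_app_morphism (U W : opens X) (h : W `<=` U) : nmod_morphism (dsum_app h).
Proof. by split=> [|x y]; rewrite /dsum_app /= ?raddf0 ?raddfD. Qed.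

HB.instance Definition _ (U W : opens X) (h : W `<=` U) :=
  GRing.isNmodMorphism.Build _ _ (dsum_app h) (dsum_app_morphism h).

Let dres (U W : opens X) (h : W `<=` U) :
  {additive (F U * G U)%type -> (F W * G W)%type} := dsum_app h.

Let dres_id (U : opens X) (h : U `<=` U) s : dres h s = s.
Proof. by case: s => s t; rewrite /= /dsum_app /= !restr_id. Qed.

Let dres_comp (U V W : opens X) (hVU : V `<=` U) (hWV : W `<=` V)
  (hWU : W `<=` U) s : dres hWV (dres hVU s) = dres hWU s.
Proof. by rewrite /= /dsum_app /= (restr_comp F _ _ hWU) (restr_comp G _ _ hWU). Qed.

Let dres_sep (U : opens X) (I : Type) (W : I -> opens X)
  (hW : forall i, W i `<=` U) : U `<=` \bigcup_i W i ->
  forall s t, (forall i, dres (hW i) s = dres (hW i) t) -> s = t.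
Proof.
move=> cov [s s'] [t t'] st; congr (_, _);
  by apply: (sheaf_separated _ hW cov) => i; case: (st i).
Qed.

Let dres_glue (U : opens X) (I : Type) (W : I -> opens X)
  (hW : forall i, W i `<=` U) : U `<=` \bigcup_i W i ->
  forall s : forall i, (F (W i) * G (W i))%type,
  (forall i j (N : opens X) (hi : N `<=` W i) (hj : N `<=` W j),
     dres hi (s i) = dres hj (s j)) ->
  exists t, forall i, dres (hW i) t = s i.
Proof.
move=> cov s ss.
have [t ht] := sheaf_glue F hW cov _ (fun i j N hi hj => congr1 fst (ss i j N hi hj)).
have [u hu] := sheaf_glue G hW cov _ (fun i j N hi hj => congr1 snd (ss i j N hi hj)).
by exists (t, u) => i; rewrite /= /dsum_app /= ht hu; case: (s i).
Qed.

Definition dsum_sheaf : sheaf X :=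
  Sheaf dres_id dres_comp dres_sep dres_glue.

End DirectSum.

Section Pushforward.
Variables (X Y : topologicalType) (f : X -> Y) (cf : continuous f).

Definition preimage_opens (U : opens Y) : opens X :=
  Opens ((continuousP f).1 cf U (opens_open U)).

Let preim_sub (U W : opens Y) (h : W `<=` U) :
  preimage_opens W `<=` preimage_opens U := fun x => h (f x).

Variable F : sheaf X.

Let pres_sep (U : opens Y) (I : Type) (W : I -> opens Y)
  (hW : forall i, W i `<=` U) : U `<=` \bigcup_i W i ->
  forall s t : F (preimage_opens U),
  (forall i, restr F (preim_sub (hW i)) s = restr F (preim_sub (hW i)) t) -> s = t.
Proof.
move=> cov s t st; apply: (@sheaf_separated _ F _ I (preimage_opens \o W)) st.
by move=> x /cov[i _ Wi]; exists i.
Qed.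

Let pres_glue (U : opens Y) (I : Type) (W : I -> opens Y)
  (hW : forall i, W i `<=` U) : U `<=` \bigcup_i W i ->
  forall s : forall i, F (preimage_opens (W i)),
  (forall i j (N : opens Y) (hi : N `<=` W i) (hj : N `<=` W j),
     restr F (preim_sub hi) (s i) = restr F (preim_sub hj) (s j)) ->
  exists t, forall i, restr F (preim_sub (hW i)) t = s i.
Proof.
move=> cov s ss; apply: (@sheaf_glue _ F _ I (preimage_opens \o W)).
  by move=> x /cov[i _ Wi]; exists i.
move=> i j N hi hj.
pose B : opens Y := Opens (openI (opens_open (W i)) (opens_open (W j))).
have hNB : N `<=` preimage_opens B by move=> x Nx; split; [exact: hi|exact: hj].
have e := ss i j B (@subIsetl _ _ _) (@subIsetr _ _ _).
have := congr1 (restr F hNB) e.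
by rewrite (restr_comp F _ _ hi) (restr_comp F _ _ hj).
Qed.

Definition pushforward : sheaf Y :=
  @Sheaf Y (fun U => F (preimage_opens U)) (fun U W h => restr F (preim_sub h))
    (fun U h s => restr_id F _ s) (fun U V W h1 h2 h3 s => restr_comp F _ _ _ s)
    pres_sep pres_glue.

End Pushforward.

(** Sections over [U] are families [s x] of elements of [E x], [x] in [U], which
    near every point of [U] are described by one index [j], in the sense that
    [lm_rel j y (s y)]. *)

Record local_model (X : Type) (E : X -> nmodType) := LocalModel {
  lm_index : Type;
  lm_rel : lm_index -> forall x, E x -> Prop;
  lm0 : exists j, forall x, lm_rel j (0 : E x);
  lmD : forall j k, exists l, forall x (a b : E x),
    lm_rel j a -> lm_rel k b -> lm_rel l (a + b)
}.

Section LocalSections.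
Variables (X : topologicalType) (E : X -> nmodType) (L : local_model E).

Definition locally_modelled (U : set X) (s : forall x, U x -> E x) : Prop :=
  forall x, U x -> exists W : set X, [/\ open W, W x, W `<=` U &
    exists j : lm_index L, forall y (hy : U y), W y -> lm_rel j (s y hy)].

Record local_section (U : set X) := LocalSection {
  sec_val :> forall x, U x -> E x;
  sec_local : locally_modelled sec_val
}.

Lemma local_section_ext (U : set X) (s t : local_section U) :
  (forall x (hx : U x), s x hx = t x hx) -> s = t.
Proof.
case: s t => [s ls] [t lt] /= st.
have e : s = t.
  by apply: functional_extensionality_dep => x;
     apply: functional_extensionality_dep => hx.
by case: t / e lt {st} => lt; congr LocalSection; exact: Prop_irrelevance.
Qed.

Section OneOpen.
Variable U : opens X.

HB.instance Definition _ := gen_eqMixin (local_section U).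
HB.instance Definition _ := gen_choiceMixin (local_section U).

Lemma lsec_zero_subproof :
  locally_modelled (fun x (_ : (U : set X) x) => 0 : E x).
Proof.
move=> x Ux; exists U; split=> //; first exact: opens_open.
by have [j hj] := lm0 L; exists j => y _ _.
Qed.

Lemma lsec_add_subproof (s t : local_section U) :
  locally_modelled (fun x hx => s x hx + t x hx).
Proof.
move=> x Ux.
have [W [oW Wx WU [j hj]]] := sec_local s Ux.
have [W' [oW' W'x W'U [k hk]]] := sec_local t Ux.
exists (W `&` W'); split; [exact: openI | by [] | by move=> y [/WU] |].
have [l hl] := lmD j k; exists l => y hy [Wy W'y].
by apply: hl; [exact: hj|exact: hk].
Qed.

Definition lsec_zero := LocalSection lsec_zero_subproof.
Definition lsec_add s t := LocalSection (lsec_add_subproof s t).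

Lemma lsec_addA : associative lsec_add.
Proof. by move=> s t u; apply: local_section_ext => x hx /=; rewrite addrA. Qed.
Lemma lsec_addC : commutative lsec_add.
Proof. by move=> s t; apply: local_section_ext => x hx /=; rewrite addrC. Qed.
Lemma lsec_add0 : left_id lsec_zero lsec_add.
Proof. by move=> s; apply: local_section_ext => x hx /=; rewrite add0r. Qed.

HB.instance Definition _ := GRing.isNmodule.Build (local_section U)
  lsec_addA lsec_addC lsec_add0.

End OneOpen.

Lemma lsec_restr_subproof (U W : opens X) (h : W `<=` U) (s : local_section U) :
  locally_modelled (fun x (hx : (W : set X) x) => s x (h x hx)).
Proof.
move=> x Wx; have [N [oN Nx NU [j hj]]] := sec_local s (h x Wx).
exists (N `&` W); split; [exact: openI (opens_open W) | by [] | by move=> y [] |].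
by exists j => y hy [Ny _]; exact: hj.
Qed.

Definition lsec_restr (U W : opens X) (h : W `<=` U) (s : local_section U) :
  local_section W := LocalSection (lsec_restr_subproof h s).

Lemma lsec_restr_morphism (U W : opens X) (h : W `<=` U) :
  nmod_morphism (lsec_restr h).
Proof. by split=> [|s t]; apply: local_section_ext. Qed.

HB.instance Definition _ (U W : opens X) (h : W `<=` U) :=
  GRing.isNmodMorphism.Build _ _ (lsec_restr h) (lsec_restr_morphism h).

Let lres (U W : opens X) (h : W `<=` U) :
  {additive local_section U -> local_section W} := lsec_restr h.

Let lres_id (U : opens X) (h : U `<=` U) s : lres h s = s.
Proof.
apply: local_section_ext => x hx /=; congr (sec_val s _); exact: Prop_irrelevance.
Qed.

Let lres_comp (U V W : opens X) (hVU : V `<=` U) (hWV : W `<=` V)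
  (hWU : W `<=` U) s : lres hWV (lres hVU s) = lres hWU s.
Proof.
apply: local_section_ext => x hx /=; congr (sec_val s _); exact: Prop_irrelevance.
Qed.

Let lres_sep (U : opens X) (I : Type) (W : I -> opens X)
  (hW : forall i, W i `<=` U) : U `<=` \bigcup_i W i ->
  forall s t, (forall i, lres (hW i) s = lres (hW i) t) -> s = t.
Proof.
move=> cov s t st; apply: local_section_ext => x hx.
have [i _ Wx] := cov x hx.
have := congr1 (fun u : local_section (W i) => u x Wx) (st i).
by rewrite /= (Prop_irrelevance (hW i x Wx) hx).
Qed.

Let lres_glue (U : opens X) (I : Type) (W : I -> opens X)
  (hW : forall i, W i `<=` U) : U `<=` \bigcup_i W i ->
  forall s : forall i, local_section (W i),
  (forall i j (N : opens X) (hi : N `<=` W i) (hj : N `<=` W j),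
     lres hi (s i) = lres hj (s j)) ->
  exists t, forall i, lres (hW i) t = s i.
Proof.
move=> cov s ss.
have cov' x (Ux : (U : set X) x) : exists i, (W i : set X) x.
  by have [i _ Wi] := cov x Ux; exists i.
pose k x hx := projT1 (cid (cov' x hx)).
have kP x hx : (W (k x hx) : set X) x := projT2 (cid (cov' x hx)).
pose t x (hx : (U : set X) x) : E x := s (k x hx) x (kP x hx).
have tE i x (hx : (U : set X) x) (Wx : (W i : set X) x) : t x hx = s i x Wx.
  pose N : opens X :=
    Opens (openI (opens_open (W (k x hx))) (opens_open (W i))).
  have := ss (k x hx) i N (@subIsetl _ _ _) (@subIsetr _ _ _).
  move=> /(congr1 (fun u : local_section N => u x (conj (kP x hx) Wx))) /=.
  rewrite /t (Prop_irrelevance (subIsetl _) (kP x hx)).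
  by rewrite (Prop_irrelevance (subIsetr _) Wx).
have lt : locally_modelled t.
  move=> x Ux; have [i _ Wx] := cov x Ux.
  have [N [oN Nx NW [j hj]]] := sec_local (s i) Wx.
  exists N; split=> //; first by move=> y /NW /hW.
  by exists j => y hy Ny; rewrite (tE i y hy (NW y Ny)); exact: hj.
exists (LocalSection lt) => i; apply: local_section_ext => x hx /=.
exact: tE.
Qed.

Definition local_sheaf : sheaf X :=
  @Sheaf X (fun U => local_section U) lres lres_id lres_comp lres_sep lres_glue.

End LocalSections.

Section ConstantSheaf.
Variables (X : topologicalType) (A : nmodType).

Definition const_rel (a : A) (x : X) (b : A) : Prop := b = a.

Lemma const_rel0 : exists a, forall x, const_rel a x 0.
Proof. by exists 0. Qed.

Lemma const_relD a b : exists c, forall x a' b',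
  const_rel a x a' -> const_rel b x b' -> const_rel c x (a' + b').
Proof. by exists (a + b) => x _ _ -> ->. Qed.

Definition const_model : local_model (fun _ : X => A) :=
  LocalModel const_rel0 const_relD.

Definition const_sheaf : sheaf X := local_sheaf const_model.

End ConstantSheaf.

(** Points are primes, [S p] is the complement of [p] in [A], and
    [D(f) = {p | f \in S p}].  The sheaf associated to
    [D(f) |-> A_f] has stalk [loc (S p)] at [p], and its sections are the
    families of germs which locally come from a fraction [a / f] in some
    [A_f]. *)

Section StructureSheaf.
Variables (X : topologicalType) (A : nmodType) (S : X -> submonoid A).

Definition frac_model_rel (af : A * A) (x : X) (e : loc (S x)) : Prop :=
  exists hf : S x af.2, e = frac af.1 hf.

Lemma frac_model0 : exists af, forall x, @frac_model_rel af x 0.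
Proof. by exists (0, 0) => x; exists (submon0 (S x)). Qed.

Lemma frac_modelD af bg : exists ch, forall x (e e' : loc (S x)),
  frac_model_rel af e -> frac_model_rel bg e' -> frac_model_rel ch (e + e').
Proof.
exists (af.1 + bg.1, af.2 + bg.2) => x _ _ [hf ->] [hg ->].
by exists (submonD hf hg); rewrite fracD.
Qed.

Definition frac_model : local_model (fun x => loc (S x)) :=
  LocalModel frac_model0 frac_modelD.

Definition structure_sheaf : sheaf X := local_sheaf frac_model.

End StructureSheaf.

Section BasicOpens.
Variables (X : Type) (A : nmodType) (S : X -> submonoid A).
Hypothesis S_prime : forall x a b, S x (a + b) -> S x a /\ S x b.

Definition basic_open (f : A) : set X := [set x | S x f].

Definition basic_topology : set_system X :=
  [set U | forall x, U x -> exists f, basic_open f x /\ basic_open f `<=` U].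

Lemma basic_topologyT : basic_topology setT.
Proof. by move=> x _; exists 0; split=> //; exact: submon0. Qed.

Lemma basic_topologyI : setI_closed basic_topology.
Proof.
move=> U W hU hW x [/hU[f [xf fU]] /hW[g [xg gW]]]; exists (f + g); split.
  exact: submonD.
by move=> y /S_prime[yf yg]; split; [exact: fU|exact: gW].
Qed.

Lemma basic_topology_bigU (I : Type) (U : I -> set X) :
  (forall i, basic_topology (U i)) -> basic_topology (\bigcup_i U i).
Proof.
move=> hU x [i _ /hU[f [xf fU]]]; exists f; split=> // y /fU Uy; by exists i.
Qed.

End BasicOpens.

HB.mixin Record isBinoid M of GRing.Nmodule M := {
  infty : M;
  addm_infty : forall a : M, a + infty = infty
}.

#[short(type="binoidType")]
HB.structure Definition Binoid := {M of GRing.Nmodule M & isBinoid M}.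

Arguments infty {s}.

Section BinoidSpectrum.
Variable M : binoidType.

Definition binoid_ideal (I : set M) : Prop :=
  I infty /\ forall a b, I b -> I (a + b).

Definition binoid_prime (I : set M) : Prop :=
  [/\ binoid_ideal I, I <> setT & forall a b, I (a + b) -> I a \/ I b].

Record binoid_spec := BinoidSpec {
  bprime_set :> M -> Prop;
  bprimeP : binoid_prime bprime_set
}.

Lemma binoid_spec_ext (p q : binoid_spec) : bprime_set p = bprime_set q -> p = q.
Proof.
case: p q => [p hp] [q hq] /= e; case: q / e hq => hq.
by congr BinoidSpec; exact: Prop_irrelevance.
Qed.

Lemma bcompl0 (p : binoid_spec) : ~ p 0.
Proof.
have [[_ pD] pT _] := bprimeP p => p0; apply: pT.
by rewrite -subTset => a _; rewrite -[a]addr0; exact: pD.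
Qed.

Lemma bcomplD (p : binoid_spec) a b : ~ p a -> ~ p b -> ~ p (a + b).
Proof. by have [_ _ h] := bprimeP p => pa pb /h[]. Qed.

Definition bcompl (p : binoid_spec) : submonoid M :=
  Submonoid (@bcompl0 p) (@bcomplD p).

Lemma bcompl_prime p a b : bcompl p (a + b) -> bcompl p a /\ bcompl p b.
Proof.
have [[_ pD] _ _] := bprimeP p => h.
by split=> pa; apply: h; [rewrite addrC|]; exact: pD.
Qed.

HB.instance Definition _ := gen_eqMixin binoid_spec.
HB.instance Definition _ := gen_choiceMixin binoid_spec.
HB.instance Definition _ := isOpenTopological.Build binoid_spec
  (basic_topologyT bcompl) (basic_topologyI bcompl_prime)
  (@basic_topology_bigU _ _ bcompl).

Lemma binoid_openE (U : set binoid_spec) :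
  open U <-> forall p, U p ->
    exists f, ~ p f /\ forall q : binoid_spec, ~ q f -> U q.
Proof. by []. Qed.

Definition binoid_structure_sheaf : sheaf binoid_spec := structure_sheaf bcompl.

(** [M_+] is the complement of the unit group. *)
Definition binoid_plus : set M := [set a | ~ is_unit a].

End BinoidSpectrum.

Section RingSpectrum.
Variable R : comPzRingType.

Definition ring_ideal (P : set R) : Prop :=
  [/\ P 0, forall a b, P a -> P b -> P (a + b) & forall a b, P b -> P (a * b)].

Definition ring_prime (P : set R) : Prop :=
  [/\ ring_ideal P, P <> setT & forall a b, P (a * b) -> P a \/ P b].

Record spec := Spec {
  prime_set :> R -> Prop;
  primeP : ring_prime prime_set
}.

Lemma spec_ext (p q : spec) : prime_set p = prime_set q -> p = q.
Proof.
case: p q => [p hp] [q hq] /= e; case: q / e hq => hq.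
by congr Spec; exact: Prop_irrelevance.
Qed.

Lemma prime_proper (p : spec) : ~ p 1.
Proof.
have [[_ _ pM] pT _] := primeP p => p1; apply: pT.
by rewrite -subTset => a _; rewrite -[a]mulr1; exact: pM.
Qed.

Lemma rcomplD (p : spec) (a b : mulmon R) :
  ~ p (of_mulmon a) -> ~ p (of_mulmon b) -> ~ p (of_mulmon (a + b)).
Proof. by have [_ _ h] := primeP p => pa pb /h[]. Qed.

Definition rcompl (p : spec) : submonoid (mulmon R) :=
  @Submonoid _ (fun a => ~ p (of_mulmon a)) (@prime_proper p) (@rcomplD p).

Lemma rcompl_prime p a b : rcompl p (a + b) -> rcompl p a /\ rcompl p b.
Proof.
have [[_ _ pM] _ _] := primeP p => h.
by split=> pa; apply: h; [rewrite addrC|]; exact: pM.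
Qed.

HB.instance Definition _ := gen_eqMixin spec.
HB.instance Definition _ := gen_choiceMixin spec.
HB.instance Definition _ := isOpenTopological.Build spec
  (basic_topologyT rcompl) (basic_topologyI rcompl_prime)
  (@basic_topology_bigU _ _ rcompl).

Lemma zariski_openE (U : set spec) :
  open U <-> forall p, U p ->
    exists f : R, ~ p f /\ forall q : spec, ~ q f -> U q.
Proof.
have -> : open U = basic_topology rcompl U by [].
split=> h p /h[f [pf fU]]; first by exists (of_mulmon f).
by exists (MulMon f).
Qed.

Definition vanishing (I : set R) : set spec := [set p | I `<=` prime_set p].

(** The structure sheaf of [Spec R], as a sheaf of multiplicative monoids: the
    addition of [R] plays no role in its sheaf of units. *)
Definition ring_structure_sheaf : sheaf spec := structure_sheaf rcompl.

End RingSpectrum.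

Section BinoidAlgebra.
Variables (K : fieldType) (M : binoidType).

Definition finite_elt := {mu : M | mu != infty}.
HB.instance Definition _ := Choice.on finite_elt.

Definition binoid_algebra := {malg K[finite_elt]}.
HB.instance Definition _ := GRing.Lmodule.on binoid_algebra.

Definition monomial (mu : M) : binoid_algebra :=
  if insub mu is Some m then << (m : finite_elt) >> else 0.

(** The bilinear extension of [monomial mu * monomial nu = monomial (mu + nu)]. *)
Definition balg_mul (a b : binoid_algebra) : binoid_algebra :=
  \sum_(m <- msupp a) \sum_(n <- msupp b) (a@_m * b@_n) *: monomial (val m + val n).

Definition lext (L : lmodType K) (F : finite_elt -> L) (a : binoid_algebra) : L :=
  \sum_(m <- msupp a) a@_m *: F m.

Lemma lextw (L : lmodType K) (F : finite_elt -> L) (a : binoid_algebra)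
  (d : {fset finite_elt}) : (msupp a `<=` d)%fset ->
  lext F a = \sum_(m <- d) a@_m *: F m.
Proof.
move=> h; apply: big_fset_incl => // m _ hm.
by rewrite mcoeff_outdom // scale0r.
Qed.

Lemma lext_lin (L : lmodType K) (F : finite_elt -> L) c (a b : binoid_algebra) :
  lext F (c *: a + b) = c *: lext F a + lext F b.
Proof.
pose d := (msupp a `|` msupp b `|` msupp (c *: a + b))%fset.
have da : (msupp a `<=` d)%fset by rewrite /d -fsetUA fsubsetUl.
have db : (msupp b `<=` d)%fset by rewrite /d [X in (X `|` _)%fset]fsetUC -fsetUA fsubsetUl.
have dab : (msupp (c *: a + b) `<=` d)%fset by rewrite /d fsubsetUr.
rewrite (lextw F da) (lextw F db) (lextw F dab).
rewrite scaler_sumr -big_split /=; apply: eq_bigr => m _.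
by rewrite mcoeffD mcoeffZ scalerDl scalerA.
Qed.

Lemma lextD (L : lmodType K) (F : finite_elt -> L) (a b : binoid_algebra) :
  lext F (a + b) = lext F a + lext F b.
Proof. by have := lext_lin F 1 a b; rewrite !scale1r. Qed.

Lemma lext0 (L : lmodType K) (F : finite_elt -> L) : lext F 0 = 0.
Proof. by rewrite /lext msupp0 big_seq_fset0. Qed.

Lemma lextZ (L : lmodType K) (F : finite_elt -> L) c (a : binoid_algebra) :
  lext F (c *: a) = c *: lext F a.
Proof. by rewrite -[c *: a]addr0 lext_lin lext0 addr0. Qed.

Lemma lext_sum (L : lmodType K) (F : finite_elt -> L) I (r : seq I)
    (f : I -> binoid_algebra) :
  lext F (\sum_(i <- r) f i) = \sum_(i <- r) lext F (f i).
Proof.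
by elim: r => [|i r IH]; rewrite ?big_nil ?lext0 // !big_cons lextD IH.
Qed.

Lemma T_infty : monomial infty = 0.
Proof. by rewrite /monomial; case: insubP => // m; rewrite eqxx. Qed.

Lemma T_finite (m : finite_elt) : monomial (val m) = << m >>.
Proof. by rewrite /monomial valK. Qed.

Lemma mcoeffT mu (m : finite_elt) : (monomial mu)@_m = (mu == val m)%:R.
Proof.
rewrite /monomial; case: insubP => [n _ <-|]; first by rewrite mcoeffU val_eqE.
rewrite negbK => /eqP ->; rewrite mcoeff0 eq_sym.
by rewrite (negbTE (valP m)).
Qed.

Lemma algE (a : binoid_algebra) : a = \sum_(m <- msupp a) a@_m *: monomial (val m).
Proof.
apply/malgP => m; rewrite {1}[a]monalgE !raddf_sum /=.
apply: eq_bigr => n _; rewrite T_finite mcoeffZ !mcoeffU.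
by case: eqP => _; rewrite ?mulr1 ?mulr0.
Qed.

Lemma lextT (L : lmodType K) (F : M -> L) (F0 : F infty = 0) mu :
  lext (fun m : finite_elt => F (val m)) (monomial mu) = F mu.
Proof.
rewrite /monomial; case: insubP => [n _ <-|].
  rewrite /lext msuppU oner_eq0 big_seq_fset1 mcoeffUU scale1r //.
by rewrite negbK => /eqP ->; rewrite lext0 F0.
Qed.

Lemma balg_mulE a b : balg_mul a b =
  lext (fun m => lext (fun n : finite_elt => monomial (val m + val n)) b) a.
Proof.
rewrite /balg_mul /lext; apply: eq_bigr => m _; rewrite scaler_sumr.
by apply: eq_bigr => n _; rewrite scalerA.
Qed.

Lemma infty_addm (a : M) : infty + a = infty.
Proof. by rewrite addrC addm_infty. Qed.

Lemma balg_mulC : commutative balg_mul.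
Proof.
move=> a b; rewrite /balg_mul exchange_big /=; apply: eq_bigr => n _.
by apply: eq_bigr => m _; rewrite mulrC addrC.
Qed.

Lemma balg_mulDl : left_distributive balg_mul +%R.
Proof. by move=> a b c; rewrite !balg_mulE lextD. Qed.

Lemma balg_mulZl c a b : balg_mul (c *: a) b = c *: balg_mul a b.
Proof. by rewrite !balg_mulE lextZ. Qed.

Lemma balg_mul_suml I (r : seq I) (f : I -> binoid_algebra) b :
  balg_mul (\sum_(i <- r) f i) b = \sum_(i <- r) balg_mul (f i) b.
Proof. by rewrite !balg_mulE lext_sum; apply: eq_bigr => i _; rewrite balg_mulE. Qed.

Lemma balg_mulTT mu nu : balg_mul (monomial mu) (monomial nu) = monomial (mu + nu).
Proof.
rewrite balg_mulE (lextT (F := fun mu => lext (fun n => monomial (mu + val n)) (monomial nu))).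
  by rewrite (lextT (F := fun nu => monomial (mu + nu))) // addm_infty T_infty.
by rewrite /lext big1 // => n _; rewrite infty_addm T_infty scaler0.
Qed.

Lemma balg_mul1 : left_id (monomial 0) balg_mul.
Proof.
move=> b; rewrite balg_mulC {1}[b]algE balg_mul_suml [RHS]algE.
by apply: eq_bigr => m _; rewrite balg_mulZl balg_mulTT addr0.
Qed.

Lemma balg_mul_ind (P : binoid_algebra -> Prop) :
  P 0 -> (forall c mu b, P b -> P (c *: monomial mu + b)) -> forall a, P a.
Proof.
move=> P0 PD a; rewrite [a]algE.
by elim: (enum_fset _) => [|m r IH]; rewrite ?big_nil ?big_cons //; exact: PD.
Qed.

Lemma balg_mul0 b : balg_mul 0 b = 0.
Proof. by rewrite balg_mulE lext0. Qed.

Lemma balg_mulr0 a : balg_mul a 0 = 0.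
Proof. by rewrite balg_mulC balg_mul0. Qed.

Lemma balg_mulDr a b c : balg_mul a (b + c) = balg_mul a b + balg_mul a c.
Proof. by rewrite balg_mulC balg_mulDl !(balg_mulC a). Qed.

Lemma balg_mulZr c a b : balg_mul a (c *: b) = c *: balg_mul a b.
Proof. by rewrite balg_mulC balg_mulZl (balg_mulC a). Qed.

Lemma balg_mulA : associative balg_mul.
Proof.
have TTc mu nu c :
    balg_mul (monomial mu) (balg_mul (monomial nu) c) = balg_mul (balg_mul (monomial mu) (monomial nu)) c.
  rewrite balg_mulTT; elim/balg_mul_ind: c => [|k la c IH].
    by rewrite !balg_mulr0.
  rewrite (balg_mulDr (monomial nu)) (balg_mulDr (monomial mu)) (balg_mulDr (monomial (mu + nu))) IH.
  rewrite (balg_mulZr k (monomial nu)) (balg_mulZr k (monomial mu)) (balg_mulZr k (monomial (mu + nu))).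
  by rewrite !balg_mulTT addrA.
have Tbc mu b c :
    balg_mul (monomial mu) (balg_mul b c) = balg_mul (balg_mul (monomial mu) b) c.
  elim/balg_mul_ind: b => [|k nu b IH]; first by rewrite !(balg_mul0, balg_mulr0).
  rewrite (balg_mulDl _ b) (balg_mulDr (monomial mu) _ b).
  rewrite (balg_mulDr (monomial mu) _ (balg_mul b c)) (balg_mulDl _ _ c) IH.
  rewrite (balg_mulZl k (monomial nu)) !(balg_mulZr k (monomial mu)).
  by rewrite (balg_mulZl k (balg_mul _ _)) TTc.
move=> a b c; elim/balg_mul_ind: a => [|k mu a IH].
  by rewrite !balg_mul0.
rewrite (balg_mulDl _ a (balg_mul b c)) IH (balg_mulDl _ a b) (balg_mulDl _ _ c).
rewrite !(balg_mulZl k (monomial mu)) (balg_mulZl k (balg_mul (monomial mu) b)).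
by rewrite Tbc.
Qed.

HB.instance Definition _ := GRing.Zmodule_isComPzRing.Build binoid_algebra
  balg_mulA balg_mulC balg_mul1 balg_mulDl.

Lemma TD mu nu : monomial mu * monomial nu = monomial (mu + nu).
Proof. exact: balg_mulTT. Qed.

Lemma T0 : monomial 0 = 1.
Proof. by []. Qed.

Lemma balg_scalerAl c (a b : binoid_algebra) : c *: (a * b) = (c *: a) * b.
Proof. by rewrite [RHS]balg_mulZl. Qed.

Lemma mcoeffM (a b : binoid_algebra) (r : finite_elt) :
  (a * b)@_r = \sum_(m <- msupp a) \sum_(n <- msupp b)
    a@_m * b@_n * (val m + val n == val r)%:R.
Proof.
rewrite [a * b]/(balg_mul a b) /balg_mul raddf_sum; apply: eq_bigr => m _ /=.
rewrite raddf_sum; apply: eq_bigr => n _ /=.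
by rewrite mcoeffZ mcoeffT.
Qed.

(** [span_ideal I] is K[I], the K-span of the [monomial mu] with [mu] in [I]. *)
Definition span_ideal (I : set M) : set binoid_algebra :=
  [set a | exists2 s : seq (K * M),
     (forall cm, cm \in s -> I cm.2) & a = \sum_(cm <- s) cm.1 *: monomial cm.2].

Lemma span_idealP (I : set M) a :
  span_ideal I a <-> forall m : finite_elt, a@_m != 0 -> I (val m).
Proof.
split=> [[s sI ->] m|h].
  rewrite raddf_sum /=; case: (boolP (has (fun cm => cm.2 == val m) s)).
    by move=> /hasP[cm /sI Icm /eqP <-].
  move=> /hasPn hs; rewrite big1_seq ?eqxx // => cm /andP[_ cms].
  by rewrite mcoeffZ mcoeffT (negbTE (hs _ cms)) mulr0.
exists [seq (a@_m, val m) | m <- msupp a].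
  by move=> cm /mapP[m ma ->] /=; apply: h; rewrite mcoeff_neq0.
by rewrite big_map /= -algE.
Qed.

Lemma span_idealT (I : set M) mu : I infty -> span_ideal I (monomial mu) <-> I mu.
Proof.
move=> I0; rewrite span_idealP; split=> [h|Imu m]; last first.
  by rewrite mcoeffT; have [<-//|_] := eqVneq mu (val m); rewrite eqxx.
have [->//|fin] := eqVneq mu infty.
have := h (exist _ mu fin); apply; rewrite mcoeffT eqxx; exact: oner_neq0.
Qed.

Lemma span_ideal_sub (I : set M) (P : set binoid_algebra) :
  ring_ideal P -> (forall mu, I mu -> P (monomial mu)) -> span_ideal I `<=` P.
Proof.
move=> [P0 PD PM] IP _ [s sI ->].
elim: s sI => [|cm s IH] sI; first by rewrite big_nil.
rewrite big_cons; apply: PD.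
  have -> : cm.1 *: monomial cm.2 = (cm.1 *: monomial 0 : binoid_algebra) * monomial cm.2.
    by rewrite -balg_scalerAl T0 mul1r.
  by apply/PM/IP/sI; rewrite mem_head.
by apply: IH => x xs; apply: sI; rewrite inE xs orbT.
Qed.

Lemma span_ideal_ideal (I : set M) : binoid_ideal I -> ring_ideal (span_ideal I).
Proof.
move=> [_ ID]; split.
- by apply/span_idealP => m; rewrite mcoeff0 eqxx.
- move=> a b /span_idealP ha /span_idealP hb; apply/span_idealP => m.
  rewrite mcoeffD; have [a0|/ha//] := eqVneq a@_m 0.
  by rewrite a0 add0r; exact: hb.
- move=> a b /span_idealP hb; apply/span_idealP => r; rewrite mcoeffM => nz.
  apply: contrapT => nIr; move/eqP: nz; apply.
  rewrite big1 // => m _; rewrite big1 // => n _.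
  have [b0|/hb In] := eqVneq b@_n 0; first by rewrite b0 mulr0 mul0r.
  have [e|_] := eqVneq (val m + val n) (val r); last by rewrite mulr0.
  by case: nIr; rewrite -e; exact: ID.
Qed.

Definition comb_spec : Type := spec binoid_algebra.
HB.instance Definition _ := gen_eqMixin comb_spec.
HB.instance Definition _ := gen_choiceMixin comb_spec.

Definition comb_open : set_system comb_spec :=
  [set U | exists2 I : set M, binoid_ideal I & U = ~` vanishing (span_ideal I)].

Lemma comb_openP (I : set M) (P : comb_spec) :
  (~` vanishing (span_ideal I)) P <-> exists2 mu, I mu & ~ prime_set P (monomial mu).
Proof.
split=> [nsub|[mu Imu nP] /=]; last first.
  move=> sub; apply: nP; apply: sub.
  by exists [:: (1, mu)]; [move=> cm; rewrite inE => /eqP ->|rewrite big_seq1 scale1r].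
apply: contrapT => h; apply: nsub; apply: span_ideal_sub.
  by case: (primeP P).
by move=> mu Imu; apply: contrapT => nP; apply: h; exists mu.
Qed.

Lemma comb_openT : comb_open setT.
Proof.
exists setT => //; apply/esym; rewrite -subTset => P _; apply/comb_openP.
by exists 0 => //; rewrite T0; exact: prime_proper.
Qed.

Lemma comb_openI : setI_closed comb_open.
Proof.
move=> _ _ [I [I0 ID] ->] [J [J0 JD] ->]; exists (I `&` J).
  by split=> // a b [Ib Jb]; split; [exact: ID|exact: JD].
apply/predeqP => P; split.
  move=> [/comb_openP[mu Imu nPmu] /comb_openP[nu Inu nPnu]].
  apply/comb_openP; exists (mu + nu).
    by split; [rewrite addrC; exact: ID|exact: JD].
  by rewrite -TD => Pmn; have [_ _ /(_ _ _ Pmn)[]] := primeP P.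
by move=> /comb_openP[mu [Imu Jmu] nP]; split; apply/comb_openP; exists mu.
Qed.

Lemma comb_open_bigU (I : Type) (U : I -> set comb_spec) :
  (forall i, comb_open (U i)) -> comb_open (\bigcup_i U i).
Proof.
move=> hU; pose J := [set mu | mu = infty \/ exists i (L : set M),
  [/\ binoid_ideal L, U i = ~` vanishing (span_ideal L) & L mu]].
exists J.
  split; first by left.
  move=> a b [->|[i [L [hL e Lb]]]]; first by left; rewrite addm_infty.
  right; exists i, L; split=> //; exact: hL.2.
apply/predeqP => P; split.
  move=> [i _ UP]; have [L hL e] := hU i; move: UP; rewrite e.
  move=> /comb_openP[mu Lmu nP]; apply/comb_openP; exists mu => //.
  by right; exists i, L.
move=> /comb_openP[mu [mu_infty|[i [L [hL e Lmu]]]] nP].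
  by case: nP; rewrite mu_infty T_infty; have [[]] := primeP P.
by exists i => //; rewrite e; apply/comb_openP; exists mu.
Qed.

HB.instance Definition _ := isOpenTopological.Build comb_spec
  comb_openT comb_openI comb_open_bigU.

Lemma comb_spec_openE (U : set comb_spec) : open U <-> comb_open U.
Proof. by []. Qed.

Definition to_comb (P : spec binoid_algebra) : comb_spec := P.

Lemma to_comb_continuous : continuous to_comb.
Proof.
apply/continuousP => U [I hI ->]; apply/zariski_openE => P.
move=> /comb_openP[mu Imu nP]; exists (monomial mu); split=> // Q nQ.
by apply/comb_openP; exists mu.
Qed.

(** Restricting a sheaf on the Zariski topology to the coarser combinatorial
    one is the direct image under the identity. *)
Definition comb_structure_sheaf : sheaf comb_spec :=
  pushforward to_comb_continuous (ring_structure_sheaf binoid_algebra).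

End BinoidAlgebra.

Section Presentation.
Variables (M : binoidType) (R : M -> M -> Prop).

Definition congruence (E : M -> M -> Prop) : Prop :=
  [/\ forall a, E a a, forall a b, E a b -> E b a,
      forall a b c, E a b -> E b c -> E a c
    & forall a b c, E a b -> E (a + c) (b + c)].

Definition gen_cong (a b : M) : Prop :=
  forall E, congruence E -> (forall x y, R x y -> E x y) -> E a b.

Lemma gen_cong_congruence : congruence gen_cong.
Proof.
split=> [a|a b h|a b c h1 h2|a b c h] E cE RE; have [h_r h_s h_t h_a] := cE.
- exact: h_r.
- by apply: h_s; exact: h.
- by apply: (h_t _ b); [exact: h1|exact: h2].
- by apply: h_a; exact: h.
Qed.

Lemma gen_congR a b : R a b -> gen_cong a b.
Proof. by move=> Rab E _ h; exact: h. Qed.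

Definition gen_congb (a b : M) : bool := `[< gen_cong a b >].

Lemma gen_congb_refl : reflexive gen_congb.
Proof. by move=> a; apply/asboolP; have [h _ _ _] := gen_cong_congruence. Qed.
Lemma gen_congb_sym : symmetric gen_congb.
Proof.
by move=> a b; have [_ h _ _] := gen_cong_congruence;
  apply/asboolP/asboolP; exact: h.
Qed.
Lemma gen_congb_trans : transitive gen_congb.
Proof.
move=> b a c /asboolP ab /asboolP bc; apply/asboolP.
by have [_ _ h _] := gen_cong_congruence; exact: h ab bc.
Qed.

Canonical gen_cong_equiv :=
  EquivRel gen_congb gen_congb_refl gen_congb_sym gen_congb_trans.

Definition presented := {eq_quot gen_cong_equiv}.
HB.instance Definition _ := Choice.on presented.
HB.instance Definition _ := Quotient.on presented.
HB.instance Definition _ := EqQuotient.on presented.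

Definition cls (a : M) : presented := \pi_presented a.

Lemma clsP a b : cls a = cls b <-> gen_cong a b.
Proof. by split=> [/eqmodP/asboolP|h]; [|apply/eqmodP/asboolP]. Qed.

Lemma reprK_cls (x : presented) : cls (repr x) = x.
Proof. exact: reprK. Qed.

Definition presented_add (x y : presented) : presented := cls (repr x + repr y).

Lemma presented_addE a b : presented_add (cls a) (cls b) = cls (a + b).
Proof.
apply/clsP; have [_ _ h_t h_a] := gen_cong_congruence.
apply: (h_t _ (a + repr (cls b))).
  by apply: h_a; apply/clsP; rewrite reprK_cls.
by rewrite ![a + _]addrC; apply: h_a; apply/clsP; rewrite reprK_cls.
Qed.

Lemma presented_addA : associative presented_add.
Proof.
move=> x y z; rewrite -(reprK_cls x) -(reprK_cls y) -(reprK_cls z).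
by rewrite !presented_addE addrA.
Qed.
Lemma presented_addC : commutative presented_add.
Proof. by move=> x y; rewrite /presented_add addrC. Qed.
Lemma presented_add0 : left_id (cls 0) presented_add.
Proof. by move=> x; rewrite -(reprK_cls x) presented_addE add0r. Qed.

HB.instance Definition _ := GRing.isNmodule.Build presented
  presented_addA presented_addC presented_add0.

Lemma clsD a b : cls (a + b) = cls a + cls b.
Proof. by rewrite -presented_addE. Qed.

Lemma presented_infty (x : presented) : x + cls infty = cls infty.
Proof. by rewrite -(reprK_cls x) -clsD addm_infty. Qed.

HB.instance Definition _ := isBinoid.Build presented presented_infty.

End Presentation.

(** The free commutative binoid on [V]: an element of [N^V], or [None] for the
    absorbing element. *)
Definition free_binoid (V : finType) : Type := option {ffun V -> nat}.

Section FreeBinoid.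
Variable V : finType.

HB.instance Definition _ := Choice.on (free_binoid V).

Definition free_add (a b : free_binoid V) : free_binoid V :=
  if a is Some m then if b is Some n then Some (m + n) else None else None.

Lemma free_addA : associative free_add.
Proof. by move=> [m|] [n|] [k|] //=; rewrite addrA. Qed.
Lemma free_addC : commutative free_add.
Proof. by move=> [m|] [n|] //=; rewrite addrC. Qed.
Lemma free_add0 : left_id (Some 0 : free_binoid V) free_add.
Proof. by move=> [m|] //=; rewrite add0r. Qed.

HB.instance Definition _ := GRing.isNmodule.Build (free_binoid V)
  free_addA free_addC free_add0.

Lemma free_infty (a : free_binoid V) : a + None = None.
Proof. by case: a. Qed.

HB.instance Definition _ := isBinoid.Build (free_binoid V) free_infty.

Definition gen (v : V) : free_binoid V := Some [ffun w => (w == v) : nat].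

End FreeBinoid.

Definition simplicial_complex (V : finType) (Delta : {set {set V}}) : Prop :=
  (forall F G : {set V}, G \subset F -> F \in Delta -> G \in Delta) /\
  (forall v : V, [set v]%SET \in Delta).

Section SimplicialBinoid.
Variables (V : finType) (Delta : {set {set V}}).

Definition nonface_rel (a b : free_binoid V) : Prop :=
  exists H : {set V}, [/\ H \notin Delta, a = \sum_(v in H) gen v & b = infty].

Definition simplicial_binoid := presented nonface_rel.
HB.instance Definition _ := Binoid.on simplicial_binoid.

Local Notation M := simplicial_binoid.

Lemma nonface_cong a b : gen_cong nonface_rel a b ->
  a = b \/ gen_cong nonface_rel a infty /\ gen_cong nonface_rel b infty.
Proof.
have [h_r h_s h_t h_a] := gen_cong_congruence nonface_rel.
move=> h; apply: (h (fun a b => a = b \/ _ a infty /\ _ b infty)).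
  split=> [|x y [->|[]]|x y z [->|[hx hy]] [<-|[hy' hz]]|x y z [->|[hx hy]]];
    [by left|by left|by right|by left|by right|by right|by right|by left|].
  by right; split; rewrite -(infty_addm z); exact: h_a.
move=> x y Rxy; right; have := gen_congR Rxy.
by case: Rxy => H [_ _ ->]; split=> //; exact: h_r.
Qed.

Definition expo (x : M) : {ffun V -> nat} := odflt 0 (repr x).

Lemma clsK_finite (a : free_binoid V) :
  cls nonface_rel a <> infty -> repr (cls nonface_rel a) = a.
Proof.
move=> fin; have /clsP/nonface_cong[//|[_ /clsP//]] :=
  reprK_cls (cls nonface_rel a).
Qed.

Lemma repr_expo (x : M) : x <> infty -> repr x = Some (expo x).
Proof.
move=> fin; rewrite /expo; case e: (repr x) => [//|]; case: fin.
by rewrite -(reprK_cls x) e.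
Qed.

Lemma expo_inj (x y : M) : x <> infty -> y <> infty -> expo x = expo y -> x = y.
Proof.
move=> hx hy e; rewrite -(reprK_cls x) -(reprK_cls y).
by rewrite (repr_expo hx) (repr_expo hy) e.
Qed.

Lemma expoD (x y : M) : x + y <> infty -> expo (x + y) = expo x + expo y.
Proof.
move=> fin.
have hx : x <> infty by move=> e; apply: fin; rewrite e addrC addm_infty.
have hy : y <> infty by move=> e; apply: fin; rewrite e addm_infty.
have e : x + y = cls nonface_rel (Some (expo x + expo y)).
  rewrite -{1}(reprK_cls x) -{1}(reprK_cls y) -clsD.
  by rewrite (repr_expo hx) (repr_expo hy).
have := clsK_finite (a := Some (expo x + expo y)); rewrite -e => /(_ fin).
by rewrite (repr_expo fin) => -[].
Qed.

Lemma expo0 : (0 : M) <> infty -> expo 0 = 0.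
Proof. by move=> h; rewrite /expo (clsK_finite (a := 0)). Qed.

Lemma simplicial_unit (x : M) : (0 : M) <> infty -> is_unit x -> x = 0.
Proof.
move=> h0 [y xy].
have hxy : x + y <> infty by rewrite xy.
apply: expo_inj => //; first by move=> e; apply: hxy; rewrite e addrC addm_infty.
rewrite expo0 //; apply/ffunP => v.
have := congr1 (fun f : {ffun V -> nat} => f v) (expoD hxy).
by rewrite xy expo0 // !ffunE; case: (expo x v).
Qed.

End SimplicialBinoid.

Section Weight.
Variable V : finType.

Fixpoint weight (B : nat) (f : V -> nat) (s : seq V) : nat :=
  if s is v :: s' then (f v + B * weight B f s')%N else 0%N.

Lemma weightD B (f g : {ffun V -> nat}) s :
  weight B (f + g) s = (weight B f s + weight B g s)%N.
Proof. by elim: s => //= v s ->; rewrite ffunE mulnDr addnACA. Qed.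

Lemma weight_inj B (f g : V -> nat) s :
  (forall v, v \in s -> (f v < B)%N) -> (forall v, v \in s -> (g v < B)%N) ->
  weight B f s = weight B g s -> forall v, v \in s -> f v = g v.
Proof.
elim: s => //= w s IH hf hg e.
have fB := hf w (mem_head _ _); have gB := hg w (mem_head _ _).
have B0 : (0 < B)%N by apply: leq_ltn_trans fB.
have := congr1 (modn^~ B) e; rewrite ![(B * _)%N]mulnC ![(_ + _ * B)%N]addnC.
rewrite !modnMDl !modn_small // => fg; move: e; rewrite fg => /addnI /eqP.
rewrite eqn_mul2l (gtn_eqF B0) /= => /eqP e v; rewrite inE => /orP[/eqP->//|].
by apply: IH => // u us; [apply: hf|apply: hg]; rewrite inE us orbT.
Qed.

End Weight.

Lemma seq_argmax (I : eqType) (w : I -> nat) (s : seq I) x : x \in s ->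
  exists2 y, y \in s & forall z, z \in s -> (w z <= w y)%N.
Proof.
elim: s x => // a [|b s] IH x _.
  by exists a; rewrite ?mem_head // => z; rewrite inE => /eqP ->.
have [y ys yM] := IH b (mem_head _ _).
have [ay|ya] := leqP (w a) (w y).
  by exists y; [rewrite inE ys orbT|move=> z; rewrite inE => /orP[/eqP->//|/yM]].
exists a; first exact: mem_head.
move=> z; rewrite inE => /orP[/eqP->//|/yM zy]; exact: leq_trans zy (ltnW ya).
Qed.

Section SimplicialSpectra.
Variables (K : fieldType) (V : finType) (Delta : {set {set V}}).

Local Notation M := (simplicial_binoid Delta).
Local Notation A := (binoid_algebra K M).

Lemma span_ideal_prime (p : binoid_spec M) :
  ring_prime (span_ideal (bprime_set p) : set A).
Proof.
have [pI pT pP] := bprimeP p; have [p_infty pD] := pI.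
split; first exact: span_ideal_ideal.
  move=> /(congr1 (fun P : set A => P 1)) e.
  have : span_ideal (bprime_set p) (monomial K 0) by rewrite T0 e.
  by move=> /(span_idealT K 0 p_infty).1; exact: bcompl0.
move=> a b /span_idealP abP; apply: contrapT => /not_orP[na nb].
have exF (c : A) : ~ span_ideal (bprime_set p) c ->
    exists2 m, m \in msupp c & ~ p (val m).
  move=> nc; apply: contrapT => h; apply: nc; apply/span_idealP => m.
  rewrite mcoeff_neq0 => mc; apply: contrapT => npm; apply: h; by exists m.
pose bnd (c : A) := \max_(m <- msupp c) \max_v expo (val m) v.
have bndP c m v : m \in msupp c -> (expo (val m) v <= bnd c)%N.
  move=> mc; rewrite /bnd (big_fsetD1 m) //=.
  apply: leq_trans (leq_maxl _ _); exact: (leq_bigmax v).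
pose B := (maxn (bnd a) (bnd b)).+1.
pose w (mu : M) := weight B (expo mu) (enum V).
have maxF (c : A) : ~ span_ideal (bprime_set p) c -> exists2 m,
    m \in msupp c & ~ p (val m) /\ forall n, n \in msupp c -> ~ p (val n) ->
      (w (val n) <= w (val m))%N.
  move=> /exF[m0 m0c nm0].
  have m0s : m0 \in [seq m <- msupp c | `[< ~ p (val m) >]].
    by rewrite mem_filter m0c andbT; apply/asboolP.
  have [m] := seq_argmax (fun m => w (val m)) m0s.
  rewrite mem_filter => /andP[/asboolP nm mc] mM; exists m => //; split=> // n nc nn.
  by apply: mM; rewrite mem_filter nc andbT; apply/asboolP.
have [m0 m0a [nm0 m0M]] := maxF a na.
have [n0 n0b [nn0 n0M]] := maxF b nb.
have nr : ~ p (val m0 + val n0) by exact: bcomplD.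
have fin (mu : M) : ~ p mu -> mu <> infty by move=> h e; apply: h; rewrite e.
have rfin : val m0 + val n0 != infty by apply/eqP/fin.
pose r : finite_elt M := exist (fun mu : M => mu != infty) _ rfin.
have key m n : m \in msupp a -> n \in msupp b ->
    val m + val n = val m0 + val n0 -> m = m0 /\ n = n0.
  move=> ma nb' e.
  have nmn : ~ p (val m + val n) by rewrite e.
  have [nm nn] := bcompl_prime nmn.
  have ew : (w (val m) + w (val n) = w (val m0) + w (val n0))%N.
    by rewrite /w -!weightD -!expoD ?e //; exact: fin.
  have wm := m0M _ ma nm; have wn := n0M _ nb' nn.
  have inj c d (x y : finite_elt M) : x \in msupp c -> y \in msupp d ->
      (bnd c < B)%N -> (bnd d < B)%N -> w (val x) = w (val y) -> x = y.
    move=> xc yd cB dB wxy; apply/val_inj/expo_inj.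
    - exact/eqP/(valP x).
    - exact/eqP/(valP y).
    apply/ffunP => v; apply: (weight_inj _ _ wxy); last by rewrite mem_enum.
    + by move=> u _; exact: leq_ltn_trans (bndP _ _ u xc) cB.
    + by move=> u _; exact: leq_ltn_trans (bndP _ _ u yd) dB.
  have aB : (bnd a < B)%N by rewrite ltnS leq_maxl.
  have bB : (bnd b < B)%N by rewrite ltnS leq_maxr.
  split.
    apply: (inj a a) => //; apply/eqP; rewrite eqn_leq wm /=.
    by rewrite -(leq_add2r (w (val n0))) -ew leq_add2l.
  apply: (inj b b) => //; apply/eqP; rewrite eqn_leq wn /=.
  by rewrite -(leq_add2l (w (val m0))) -ew leq_add2r.
have inner0 m : m != m0 -> m \in msupp a ->
    \sum_(n <- msupp b) a@_m * b@_n * (val m + val n == val r)%:R = 0.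
  move=> mm0 ma; apply: big1_seq => n /andP[_ nb'].
  case: eqVneq => [e|_]; last by rewrite mulr0.
  by have [mm _] := key m n ma nb' e; rewrite mm eqxx in mm0.
have inner :
    \sum_(n <- msupp b) a@_m0 * b@_n * (val m0 + val n == val r)%:R
      = a@_m0 * b@_n0.
  pose F (n : finite_elt M) : K := a@_m0 * b@_n * (val m0 + val n == val r)%:R.
  have rest : \sum_(n <- (msupp b `\ n0)%fset) F n = 0.
    apply: big1_seq => n /andP[_]; rewrite in_fsetD1 => /andP[nn0' nb'].
    rewrite /F; case: eqVneq => [e|_]; last by rewrite mulr0.
    by have [_ nn] := key m0 n m0a nb' e; rewrite nn eqxx in nn0'.
  apply: (etrans (@big_fsetD1 K 0 +%R _ n0 (msupp b) F n0b)).
  by rewrite -[LHS]/(F n0 + \sum_(n <- (msupp b `\ n0)%fset) F n) rest addr0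
             /F eqxx mulr1.
have coef : (a * b)@_r = a@_m0 * b@_n0.
  rewrite mcoeffM -inner.
  pose F (m : finite_elt M) : K :=
    \sum_(n <- msupp b) a@_m * b@_n * (val m + val n == val r)%:R.
  have rest : \sum_(m <- (msupp a `\ m0)%fset) F m = 0.
    apply: big1_seq => m /andP[_]; rewrite in_fsetD1 => /andP[]; exact: inner0.
  apply: (etrans (@big_fsetD1 K 0 +%R _ m0 (msupp a) F m0a)).
  by rewrite -[LHS]/(F m0 + \sum_(m <- (msupp a `\ m0)%fset) F m) rest addr0.
by apply: nr; apply: (abP r); rewrite coef mulf_neq0 // mcoeff_neq0.
Qed.

Definition i_map (p : binoid_spec M) : comb_spec K M :=
  Spec (span_ideal_prime p).

Lemma i_map_continuous : continuous i_map.
Proof.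
apply/continuousP => U [I hI ->]; apply/binoid_openE => p /comb_openP[mu Imu nmu].
have [[p_infty _] _ _] := bprimeP p.
exists mu; split; first by move=> pmu; apply: nmu; apply/(span_idealT K mu p_infty).2.
move=> q nq; apply/comb_openP; exists mu => //.
by have [[q_infty _] _ _] := bprimeP q; move=> /(span_idealT K mu q_infty).1.
Qed.

Definition punctured : set (comb_spec K M) :=
  [set P | prime_set P <> span_ideal (@binoid_plus M)].

Lemma punctured_open : open punctured.
Proof.
have [z|h0] := pselect ((0 : M) = infty).
  have -> : punctured = setT.
    rewrite -subTset => P _; case: (@prime_proper _ P).
    by rewrite -T0 z T_infty; have [[]] := primeP P.
  exact: openT.
have plusE (mu : M) : binoid_plus mu <-> mu <> 0.
  split=> [nu e|n0 /(simplicial_unit h0)//]; apply: nu; rewrite e; exact: is_unit0.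
exists (@binoid_plus M).
  split; first by apply/plusE => e; exact: h0.
  by move=> a b nb [c hc]; apply: nb; exists (a + c); rewrite addrCA addrA.
apply/predeqP => P; split=> [hP sub|nsub e]; last by apply: nsub; rewrite -e.
apply: hP; apply/seteqP; split=> [a Pa|]; last exact: sub.
apply/span_idealP => m am; apply/plusE => m0.
have [[P0 PD PM] PT _] := primeP P.
have Pb : P (a - a@_m *: monomial K 0).
  apply: sub; apply/span_idealP => n; rewrite mcoeffB mcoeffZ mcoeffT -m0 => nz.
  apply/plusE => n0; move: nz; rewrite -m0 in n0.
  by rewrite n0 eqxx mulr1 (val_inj n0) subrr eqxx.
apply: (@prime_proper _ P).
have -> : (1 : A) = ((a@_m)^-1 *: monomial K 0) * (a + (- monomial K 0) * (a - a@_m *: monomial K 0)).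
  rewrite -balg_scalerAl T0 mul1r mulN1r opprB addrC subrK scalerA mulVf //.
  by rewrite scale1r.
by apply: (PM); apply: PD => //; exact: PM.
Qed.

Definition punctured_opens : opens (comb_spec K M) := Opens punctured_open.

End SimplicialSpectra.

Section Splitting.
Variables (K : fieldType) (V : finType) (Delta : {set {set V}}).

Local Notation M := (simplicial_binoid Delta).

Definition units_SR : sheaf (comb_spec K M) :=
  units_sheaf (comb_structure_sheaf K M).

Definition units_binoid : sheaf (binoid_spec M) :=
  units_sheaf (binoid_structure_sheaf M).

Definition const_units : sheaf (comb_spec K M) :=
  const_sheaf (comb_spec K M) (units (mulmon K)).

Definition split_sheaf : sheaf (comb_spec K M) :=
  dsum_sheaf (pushforward (@i_map_continuous K V Delta) units_binoid)
             const_units.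

(** [phi] is the sum of the two natural embeddings.  At a prime [P] of
    [K[Delta]], with [p = {mu | monomial mu \in P}], a pair [(s, c)] where
    [s p = mu - nu] is sent to the germ [c P *: monomial mu / monomial nu]. *)
Definition natural_embedding
    (phi : sheaf_hom_on (punctured_opens K Delta) split_sheaf units_SR) : Prop :=
  forall (U : opens (comb_spec K M)) (hU : U `<=` punctured_opens K Delta)
    (s : units_binoid (preimage_opens (@i_map_continuous K V Delta) U))
    (c : const_units U)
    (P : comb_spec K M) (hP : in_opens U P)
    (p : binoid_spec M) (hp : in_opens U (i_map K p)),
    (forall mu, p mu <-> prime_set P (monomial K mu)) ->
    forall (mu nu : M) (p_nu : bcompl p nu)
      (P_nu : rcompl P (MulMon (monomial K nu))),
    sec_val (val s) hp = frac mu p_nu ->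
    sec_val (val (sheaf_app phi hU (s, c))) hP
      = frac (MulMon (of_mulmon (val (sec_val c hP)) *: monomial K mu)) P_nu.

End Splitting.

(* Main.v *)
From HB Require Import structures.
From mathcomp Require Import all_boot all_algebra.
From mathcomp Require Import classical_sets topology_structure.
From mathcomp Require Import finmap boolp monalg.
Require Import Defs.

Set Implicit Arguments.
Unset Strict Implicit.
Unset Printing Implicit Defensive.

Import GRing.Theory.
Local Open Scope ring_scope.
Local Open Scope classical_set_scope.

(** In the combinatorial topology a point [P] of [Spec K[M]] has a smallest
    neighbourhood [D(f)], where [f] is the sum of the vertices whose monomial
    is not in [P].  So it suffices to find the units on such [D(f)] and to check
    uniqueness of the decomposition at the points [i p].  As [K[M]] is reduced,
    a unit on [D(f)] is [a / f^n] with [a] dividing a power of [T^f].  Modulo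
    each prime [K[q]] with [f] not in [q] the quotient is a polynomial ring, in
    which divisors of a monomial are monomials up to scalars; Kronecker
    substitution reduces this to [K[X]].  The monomials found for the various
    [q] agree with the one for the largest such [q], and the remaining terms of
    [a] are killed by [T^f]. *)

(** * An isomorphism criterion for morphisms of sheaves *)

Lemma sheaf_iso_local (X : topologicalType) (Y : opens X) (F G : sheaf X)
    (phi : sheaf_hom_on Y F G) :
  (forall (U : opens X) (hU : U `<=` Y), injective (sheaf_app phi hU)) ->
  (forall (U : opens X) (hU : U `<=` Y) (t : G U) x, in_opens U x ->
    exists (W : opens X) (hWU : W `<=` U), in_opens W x /\
    exists s : F W, sheaf_app phi (subset_trans hWU hU) s = restr G hWU t) ->
  is_sheaf_iso phi.
Proof.
move=> inj loc U hU.
suff surj t : exists s, sheaf_app phi hU s = t.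
  pose g t := projT1 (cid (surj t)).
  have gK t : sheaf_app phi hU (g t) = t := projT2 (cid (surj t)).
  by exists g => // s; apply: inj; exact: gK.
pose I := {x | in_opens U x}.
pose hW (i : I) := cid (loc U hU t (sval i) (svalP i)).
pose W i := projT1 (hW i).
pose hWU i := projT1 (cid (projT2 (hW i))).
have Wx i : in_opens (W i) (sval i) := (projT2 (cid (projT2 (hW i)))).1.
pose sP i := cid (projT2 (cid (projT2 (hW i)))).2.
pose s i : F (W i) := projT1 (sP i).
have sE i : sheaf_app phi (subset_trans (hWU i) hU) (s i) = restr G (hWU i) t :=
  projT2 (sP i).
have cov : U `<=` \bigcup_i W i by move=> x Ux; exists (exist _ x Ux); last exact: Wx.
have [s0 s0P] : exists s0 : F U, forall i, restr F (hWU i) s0 = s i.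
  apply: (sheaf_glue F hWU cov) => i j N hi hj.
  have hN k (hk : N `<=` W k) : N `<=` Y.
    exact: subset_trans hk (subset_trans (hWU k) hU).
  (* Injectivity over [N] makes the chosen local preimages agree on overlaps, so they glue. *)
  apply: (inj _ (hN i hi)).
  rewrite (sheaf_natural phi (subset_trans (hWU i) hU)) sE.
  rewrite (sheaf_natural phi (subset_trans (hWU j) hU)) sE.
  by rewrite !(restr_comp G _ _ (subset_trans hi (hWU i))).
exists s0; apply: (sheaf_separated G hWU cov) => i.
by rewrite -sE -s0P (sheaf_natural phi hU).
Qed.

(** * Sections over a basic open set of a reduced ring *)

Section RingSections.
Variable R : comPzRingType.

(* The empty chain has empty union, so [set0] has to be admitted; no maximal
   element can be [set0] since [J] lies above it. *)
Lemma prime_avoidance (J : set R) (f : R) :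
  ring_ideal J -> (forall n, ~ J (f ^+ n)) ->
  exists2 P : spec R, J `<=` prime_set P & ~ prime_set P f.
Proof.
move=> idJ Jf.
pose good (A : set R) := [/\ ring_ideal A, J `<=` A & forall n, ~ A (f ^+ n)].
have [|A [Agood Amax]] := @Zorn_bigcup R (fun A => A = set0 \/ good A).
  move=> C CP tot; have [[B CB [b Bb]]|C0] := pselect (exists2 B, C B & B !=set0).
    right; have Cgood D d : C D -> D d -> good D.
      by move=> /CP[->|].
    have [[B0 BD BM] JB Bf] := Cgood _ _ CB Bb; split.
    + split; first by exists B.
        move=> x y [D CD Dx] [D' CD' D'y].
        have [/(_ _ Dx) D'x|/(_ _ D'y) Dy] := tot _ _ CD CD'.
          by exists D' => //; have [[_ + _] _ _] := Cgood _ _ CD' D'y; apply.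
        by exists D => //; have [[_ + _] _ _] := Cgood _ _ CD Dx; apply.
      move=> x y [D CD Dy]; exists D => //.
      by have [[_ _ +] _ _] := Cgood _ _ CD Dy; apply.
    + by move=> x Jx; exists B => //; exact: JB.
    + by move=> n [D CD Dn]; have [_ _ /(_ n)] := Cgood _ _ CD Dn.
  left; rewrite -subset0 => x [D CD Dx]; apply: C0; exists D => //; by exists x.
have [J0 _ _] := idJ.
have [idA JA Af] : good A.
  case: Agood => // A0; case: (Amax J); last by right; split.
  by rewrite A0; split=> // /(_ _ J0).
have [A0 AD AM] := idA.
(* Maximality of [A], applied to the ideal [A + (x)]. *)
have ext x : ~ A x -> exists a r n, A a /\ f ^+ n = a + r * x.
  move=> nAx; pose B : set R := [set y | exists a r, A a /\ y = a + r * x].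
  have AB : A `<=` B by move=> a Aa; exists a, 0; rewrite mul0r addr0.
  have Bx : B x by exists 0, 1; rewrite mul1r add0r.
  apply: contrapT => h; apply: (Amax B); first by split=> // /(_ _ Bx).
  right; split; [split| |].
  - exact: AB.
  - move=> _ _ [a [r [Aa ->]]] [b [s [Ab ->]]]; exists (a + b), (r + s).
    by split; [exact: (AD)|rewrite mulrDl addrACA].
  - move=> y _ [a [r [Aa ->]]]; exists (y * a), (y * r).
    by split; [exact: AM|rewrite mulrDr mulrA].
  - exact: subset_trans AB.
  - by move=> n [a [r [Aa e]]]; apply: h; exists a, r, n.
have prA : ring_prime A.
  split=> //; first by move=> AT; apply: (Af 0%N); rewrite AT.
  move=> x y Axy; apply: contrapT => /not_orP[/ext[a [r [n [Aa en]]]]].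
  move=> /ext[b [s [m [Ab em]]]]; apply: (Af (n + m)%N).
  rewrite exprD en em mulrDl; apply: (AD); first by rewrite mulrC; exact: AM.
  rewrite mulrDr; apply: (AD); first exact: AM.
  by rewrite mulrACA; exact: AM.
exists (Spec prA) => //= Afn; exact: (Af 1%N).
Qed.

Hypothesis reduced : forall x : R, (forall P : spec R, prime_set P x) -> x = 0.

Lemma frac_ringE (P : spec R) (a s b t : R) (hs : rcompl P (MulMon s))
    (ht : rcompl P (MulMon t)) :
  frac (MulMon a) hs = frac (MulMon b) ht <->
  exists2 u, ~ prime_set P u & u * (a * t) = u * (b * s).
Proof.
split=> [/fracE[[u] Pu e]|[u Pu e]]; first by exists u; last exact: (congr1 (@of_mulmon R) e).
by apply/fracE; exists (MulMon u) => //; congr MulMon.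
Qed.

(* The denominators of [s] form an ideal; as [R] is reduced, a local fraction
   [x / y] valid on [D(g)] yields the global denominator [g * y], without
   appeal to quasi-compactness. *)
Lemma section_basic_open (U : opens (spec R)) (f : R) (s : ring_structure_sheaf R U) :
  (forall P, in_opens U P <-> ~ prime_set P f) ->
  exists (n : nat) (a : R), forall P (hP : in_opens U P) (hf : rcompl P (MulMon (f ^+ n))),
    sec_val s hP = frac (MulMon a) hf.
Proof.
move=> Uf.
have pow (P : spec R) n : prime_set P (f ^+ n) -> prime_set P f.
  have [_ _ PM] := primeP P.
  by elim: n => [/prime_proper|n IH]//; rewrite exprS => /PM[|/IH].
pose one (P : spec R) x := frac (MulMon x) (submon0 (rcompl P)).
pose J := [set b | exists a, forall P (hP : in_opens U P),
  one P b + sec_val s hP = one P a].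
have denE (P : spec R) x y (hy : rcompl P (MulMon y)) b a :
    one P b + frac (MulMon x) hy = one P a <->
    exists2 u, ~ prime_set P u & u * (b * x) = u * (a * y).
  rewrite /one fracD; split=> [/frac_ringE[u Pu]|[u Pu e]].
    by rewrite /= mulr1 mul1r; exists u.
  by apply/frac_ringE; exists u => //=; rewrite mulr1 mul1r.
have idJ : ring_ideal J.
  split.
  - exists 0 => P hP; have [[x] [[y] [hy ->]]] := frac_surj (sec_val s hP).
    by apply/denE; exists 1; [exact: prime_proper|rewrite !mul0r].
  - move=> b b' [a ha] [a' ha']; exists (a + a') => P hP.
    move: (ha P hP) (ha' P hP).
    have [[x] [[y] [hy ->]]] := frac_surj (sec_val s hP).
    move=> /denE[u Pu e] /denE[v Pv e']; apply/denE; exists (u * v).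
      by have [_ _ PM] := primeP P => /PM[].
    rewrite !mulrDl !mulrDr; congr (_ + _).
      by rewrite [u * v]mulrC -!mulrA e.
    by rewrite -!mulrA e'.
  - move=> c b [a ha]; exists (c * a) => P hP; move: (ha P hP).
    have [[x] [[y] [hy ->]]] := frac_surj (sec_val s hP).
    move=> /denE[u Pu e]; apply/denE; exists u => //.
    by rewrite -!mulrA ![u * (c * _)]mulrCA e.
have loc P (hP : in_opens U P) : exists2 b, J b & ~ prime_set P b.
  have [W [oW WP WU [[[x] [y]] hxy]]] := sec_local s hP.
  have [g [Pg gW]] := (zariski_openE W).1 oW P WP.
  have [Py _] := hxy P hP WP.
  exists (g * y); last by have [_ _ PM] := primeP P => /PM[].
  exists (g * x) => Q hQ.
  have [W' [oW' W'Q W'U [[[x'] [y']] hxy']]] := sec_local s hQ.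
  have [g' [Qg' g'W']] := (zariski_openE W').1 oW' Q W'Q.
  have [Qy' ->] := hxy' Q hQ W'Q; apply/denE; exists g' => //.
  (* The equation is tested at every prime [N]: it is trivial where [g] or [g'] lies in [N], and
     elsewhere both local fractions represent the germ of [s] at [N]. *)
  apply/eqP; rewrite -subr_eq0; apply/eqP/reduced => N.
  rewrite -mulrBr -!mulrA -mulrBr.
  have [[N0 ND NM] _ _] := primeP N.
  have [Ng'|Ng'] := pselect (prime_set N g'); first by rewrite mulrC; apply: (NM).
  have [Ng|Ng] := pselect (prime_set N g); first by apply: (NM); rewrite mulrC; apply: (NM).
  have hN := WU _ (gW N Ng).
  have [Ny e] := hxy N hN (gW N Ng); have [Ny' e'] := hxy' N hN (g'W' N Ng').
  move: e'; rewrite e => /frac_ringE[u Nu /= euv].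
  have : prime_set N (u * (y * x' - x * y')).
    by rewrite mulrBr euv [y * x']mulrC subrr.
  have [_ _ /(_ _ _)/[apply]-[//|]] := primeP N.
  by move=> h; do 2! apply: (NM).
have [[n [a ha]]|nJ] := pselect (exists n, J (f ^+ n)).
  exists n, a => P hP hf; move: (ha P hP).
  have [[x] [[y] [hy ->]]] := frac_surj (sec_val s hP).
  move=> /denE[u Pu e]; apply/frac_ringE; exists u => //=.
  by rewrite [x * _]mulrC.
(* A prime containing [J] but not [f] would be a point of [U], where [loc] supplies an element of
   [J] outside it. *)
have [P JP nPf] := prime_avoidance idJ (fun n h => nJ (ex_intro _ n h)).
by have [b /JP] := loc P ((Uf P).2 nPf).
Qed.

End RingSections.

(** * Primes of a binoid avoiding a given element *)

Section FaceOf.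
Variable M : binoidType.

Lemma bcompl_muln (p : binoid_spec M) (mu : M) k : ~ p mu -> ~ p (mu *+ k).
Proof.
move=> pmu; elim: k => [|k IH]; first by rewrite mulr0n; exact: bcompl0.
by rewrite mulrS; exact: bcomplD.
Qed.

Hypothesis radical : forall (mu : M) k, mu *+ k = infty -> mu = infty.

(* The complement of this prime is the face spanned by [mu]: all summands of
   multiples of [mu]. *)
Lemma prime_avoiding (mu : M) : mu <> infty -> exists q : binoid_spec M, ~ q mu.
Proof.
move=> mu_fin; pose q : set M := [set nu | forall k lam, nu + lam <> mu *+ k].
have q_prime : binoid_prime q.
  split; first split.
  (* Since [infty] absorbs [lam], it lies in [q] as soon as no multiple of [mu] is [infty]. *)
  - by move=> k lam; rewrite infty_addm => /esym/radical.
  - move=> a b qb k lam; rewrite [a + b]addrC -addrA; exact: qb.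
  - move=> qT; have : q 0 by rewrite qT.
    by move=> /(_ 0%N 0); rewrite addr0 mulr0n.
  - move=> a b qab; apply: contrapT => /not_orP[/existsNP[k /existsNP[la /contrapT ea]]].
    move=> /existsNP[l /existsNP[lb /contrapT eb]]; apply: (qab (k + l)%N (la + lb)).
    by rewrite addrACA ea eb mulrnDr.
by exists (BinoidSpec q_prime) => /(_ 1%N 0); apply; rewrite addr0.
Qed.

End FaceOf.

(** * Nonfaces, vertices and faces in the simplicial binoid *)

Section SimplicialFaces.
Variables (V : finType) (Delta : {set {set V}}).
Local Notation M := (simplicial_binoid Delta).
Local Notation vertex v := (cls (nonface_rel Delta) (gen v)).

Lemma some_sum (I : finType) (P : pred I) (F : I -> {ffun V -> nat}) :
  (Some (\sum_(i | P i) F i) : free_binoid V) =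
  \sum_(i | P i) (Some (F i) : free_binoid V).
Proof. by rewrite (big_morph _ (id1 := (0 : free_binoid V)) (op1 := +%R)). Qed.

Lemma someMn (e : {ffun V -> nat}) k :
  (Some (e *+ k) : free_binoid V) = (Some e : free_binoid V) *+ k.
Proof. by elim: k => // k IH; rewrite [in LHS]mulrS mulrS -IH. Qed.

Lemma sum_gen (H : {set V}) :
  \sum_(v in H) gen v = Some [ffun w => (w \in H) : nat].
Proof.
rewrite -some_sum; congr Some.
apply/ffunP => w; rewrite sum_ffunE ffunE.
have [wH|wH] := boolP (w \in H).
  rewrite (bigD1 w) //= ffunE eqxx big1 // => v /andP[_ vw].
  by rewrite ffunE eq_sym (negbTE vw).
rewrite big1 // => v vH; rewrite ffunE; case: eqP => // wv.
by rewrite wv vH in wH.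
Qed.

Definition contains_nonface (a : free_binoid V) : Prop :=
  if a is Some e then exists2 H : {set V}, H \notin Delta & forall v, v \in H -> (0 < e v)%N
  else True.

(** Being equal or both containing a nonface is a congruence that includes the defining relations,
    so it contains the generated one. Conversely, the indicator of a nonface splits off as a
    summand, which the relations send to [infty]. *)
Lemma contains_nonfaceP a :
  gen_cong (nonface_rel Delta) a infty <-> contains_nonface a.
Proof.
split=> [|].
  move=> /(_ (fun a b => a = b \/ contains_nonface a /\ contains_nonface b)).
  have badD x y : contains_nonface x -> contains_nonface (x + y).
    case: x y => [x|] [y|] //= [H HD xH]; exists H => // v /xH.
    by rewrite ffunE addn_gt0 => ->.
  case=> [||->|[]//]//.
    split=> [x|x y|x y z|x y z].
    - by left.
    - by case=> [->|[]]; [left|right].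
    - by case=> [->|[hx hy]]// [<-|[_ hz]]; right.
    - by case=> [->|[hx hy]]; [left|right; split; exact: badD].
  move=> _ _ [H [HD -> ->]]; right; split=> //; rewrite sum_gen.
  by exists H => // v vH; rewrite ffunE vH.
have [h_r _ _ h_a] := gen_cong_congruence (nonface_rel Delta).
case: a => [e [H HD eH]|_]; last exact: h_r.
have -> : Some e = \sum_(v in H) gen v + Some [ffun v => (e v - (v \in H))%N].
  rewrite sum_gen; congr Some; apply/ffunP => v; rewrite !ffunE.
  by rewrite [RHS]subnKC //; case: (boolP (v \in H)) => // /eH.
have: nonface_rel Delta (\sum_(v in H) gen v) infty by exists H.
move=> /gen_congR/h_a-/(_ (Some [ffun v => (e v - (v \in H))%N])).
by rewrite [infty + _]infty_addm.
Qed.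

Lemma clsMn (a : free_binoid V) k :
  cls (nonface_rel Delta) (a *+ k) = cls (nonface_rel Delta) a *+ k.
Proof. by elim: k => [|k IH]; rewrite ?mulr0n // !mulrS clsD IH. Qed.

(** Passing to a positive multiple does not change the support of an exponent vector, hence not the
    nonfaces contained in it. *)
Lemma simplicial_radical (mu : M) k : mu *+ k = infty -> mu = infty.
Proof.
(* For [k = 0] the equation says [0 = infty], which collapses the binoid. *)
case: k => [|k]; first by rewrite mulr0n => e; rewrite -[mu]addr0 e addm_infty.
rewrite -(reprK_cls mu) -clsMn => /clsP/contains_nonfaceP bad.
apply/clsP/contains_nonfaceP; case: (repr mu) bad => // e.
rewrite -someMn => -[H HD eH]; exists H => // v /eH; rewrite ffunMnE.
by case: (e v) => //; rewrite mul0rn.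
Qed.

Lemma vertex_sum (mu : M) : mu <> infty -> mu = \sum_v vertex v *+ expo mu v.
Proof.
move=> fin; rewrite -[LHS]reprK_cls (repr_expo fin); set e := expo mu.
have -> : Some e = \sum_v gen v *+ e v.
  rewrite {1}(_ : e = \sum_v [ffun w => (w == v) : nat] *+ e v).
    by rewrite some_sum; apply: eq_bigr => v _; rewrite someMn.
  apply/ffunP => w; rewrite sum_ffunE (bigD1 w) //= ffunMnE ffunE eqxx big1.
    by rewrite addr0 natn.
  by move=> v vw; rewrite ffunMnE ffunE eq_sym (negbTE vw) mul0rn.
rewrite (big_morph (cls (nonface_rel Delta)) (id1 := 0) (op1 := +%R)) //.
  by apply: eq_bigr => v _; rewrite clsMn.
by move=> x y; exact: clsD.
Qed.

(** The element [f] for which [D(f)] is the smallest neighbourhood of [p]. *)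
Definition face_sum (p : binoid_spec M) : M :=
  \sum_(v | ~~ `[< p (vertex v) >]) vertex v.

Lemma face_sum_compl (p : binoid_spec M) : ~ p (face_sum p).
Proof.
rewrite /face_sum; elim/big_ind: _ => [|x y|v /asboolP//].
  exact: bcompl0.
exact: bcomplD.
Qed.

(** The property passes to sums, so it suffices to treat the vertices that occur in [mu]; each lies
    outside [p] and is thus a summand of [face_sum p]. *)
Lemma face_sum_multiple (p : binoid_spec M) (mu : M) : ~ p mu ->
  exists k lam, mu + lam = face_sum p *+ k.
Proof.
have [[p_infty pD] _ _] := bprimeP p => pmu.
have fin : mu <> infty by move=> e; rewrite e in pmu.
pose D (x : M) := exists k lam, x + lam = face_sum p *+ k.
have D0 : D 0 by exists 0%N, 0; rewrite addr0.
have DD x y : D x -> D y -> D (x + y).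
  move=> [k [lam e]] [l [lam' e']]; exists (k + l)%N, (lam + lam').
  by rewrite addrACA e e' mulrnDr.
suff : D mu by [].
rewrite (vertex_sum fin); elim/big_ind: _ => // v _.
have [pv|pv] := pselect (p (vertex v)).
  case ev: (expo mu v) => [//|n]; case: pmu; rewrite (vertex_sum fin) (bigD1 v) //=.
  by rewrite ev mulrS addrC addrA [_ + vertex v]addrC -addrA addrC; exact: pD.
elim: (expo mu v) => [//|n IH]; rewrite mulrS; apply: DD => //.
exists 1%N, (\sum_(w | ~~ `[< p (vertex w) >] && (w != v)) vertex w).
by rewrite mulr1n /face_sum [RHS](bigD1 v) //; apply/asboolP.
Qed.

End SimplicialFaces.

(** * Divisors of monomials in the Stanley-Reisner ring *)

Section MonomialFactor.
Variables (K : fieldType) (V : finType) (Delta : {set {set V}}).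
Local Notation M := (simplicial_binoid Delta).
Local Notation A := (binoid_algebra K M).

(** A monomial with nonzero coefficient is not [infty], so some prime [q] avoids it, and then the
    prime [K[q]] does not contain [a]. *)
Lemma algebra_reduced (a : A) : (forall P : spec A, prime_set P a) -> a = 0.
Proof.
move=> aP; apply/malgP => m; rewrite mcoeff0; apply: contrapT => /eqP am.
have /eqP/prime_avoiding[|q qm] := valP m; first exact: simplicial_radical.
have /span_idealP/(_ m am) := aP (Spec (span_ideal_prime K q)).
exact: qm.
Qed.

Section Kronecker.
Variables (q : binoid_spec M) (B : nat).

Definition kronecker_monomial (mu : M) : {poly K} :=
  if `[< q mu >] then 0 else 'X^(weight B (expo mu) (enum V)).

(* Kronecker substitution: the ring morphism [K[M] -> K[X]] killing the prime
   [q] and sending the [i]-th vertex to [X^(B^i)]. *)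
Definition kronecker (a : A) : {poly K} :=
  lext (fun m : finite_elt M => kronecker_monomial (val m)) a.

Lemma kroneckerT mu : kronecker (monomial K mu) = kronecker_monomial mu.
Proof.
apply: lextT; rewrite /kronecker_monomial asboolT //.
by have [[]] := bprimeP q.
Qed.

Lemma kronecker_monomialD mu nu : kronecker_monomial (mu + nu) =
  kronecker_monomial mu * kronecker_monomial nu.
Proof.
have [[q_infty qD] _ _] := bprimeP q; rewrite /kronecker_monomial.
have [qmn|qmn] := pselect (q (mu + nu)).
  rewrite asboolT //; have [_ _ qP] := bprimeP q.
  by have [h|h] := qP _ _ qmn; rewrite [in RHS](asboolT h) ?mul0r ?mulr0.
rewrite asboolF //.
have [qm qn] := bcompl_prime qmn.
rewrite !asboolF // -exprD -weightD -expoD // => e.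
by apply: qmn; rewrite e.
Qed.

(** Both sides are bilinear, which reduces the claim to monomials: first in [b], then in [a]. *)
Lemma kroneckerM a b : kronecker (a * b) = kronecker a * kronecker b.
Proof.
have lin c x y : kronecker (c *: x + y) = c *: kronecker x + kronecker y.
  exact: lext_lin.
have T_mul mu : kronecker (monomial K mu * b) = kronecker_monomial mu * kronecker b.
  elim/balg_mul_ind: b => [|d nu b IHb].
    by rewrite mulr0 /kronecker lext0 mulr0.
  have -> : monomial K mu * (d *: monomial K nu + b)
      = d *: monomial K (mu + nu) + monomial K mu * b.
    rewrite (mulrDr (monomial K mu) (d *: monomial K nu)).
    rewrite (mulrC (monomial K mu) (d *: _)) -(balg_scalerAl d (monomial K nu)).
    by rewrite (mulrC (monomial K nu)) TD.
  apply: (etrans (lin _ _ _)); rewrite IHb kroneckerT kronecker_monomialD.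
  apply: etrans (congr1 _ (esym (lin _ _ _))).
  by rewrite kroneckerT mulrDr -scalerAr.
elim/balg_mul_ind: a => [|c mu a IHa].
  by rewrite mul0r /kronecker lext0 mul0r.
rewrite (mulrDl (c *: monomial K mu) a b) -(balg_scalerAl c (monomial K mu) b).
apply: (etrans (lin _ _ _)).
apply: (etrans (f_equal2 +%R (f_equal ( *:%R c) (T_mul mu)) IHa)).
apply: etrans (congr1 ( *%R^~ _) (esym (lin _ _ _))).
by rewrite kroneckerT mulrDl -scalerAl.
Qed.

End Kronecker.

(** The image of [a] under Kronecker substitution divides a power of [X], so it is a single term
    [c X^k]. As the weights separate the monomials of [a], one and only one of them lies outside
    [q]. *)
Lemma monomial_mod_prime (q : binoid_spec M) (a b : A) (r : M) :
  ~ q r -> a * b = monomial K r ->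
  exists m : finite_elt M, [/\ a@_m != 0, ~ q (val m) &
    forall n : finite_elt M, a@_n != 0 -> ~ q (val n) -> n = m].
Proof.
(* Only [a] is read off from its image, so the base has to exceed just the exponents occurring in
   [a]; the successor makes the bound strict. *)
move=> qr ab; pose B := (\max_(m <- msupp a) \max_v expo (val m) v).+1.
have expoB m v : m \in msupp a -> (expo (val m) v < B)%N.
  move=> ma; rewrite ltnS /B (big_fsetD1 m) //=.
  by apply: leq_trans (leq_maxl _ _); exact: (leq_bigmax v).
pose w (mu : M) := weight B (expo mu) (enum V).
have w_inj m n : m \in msupp a -> n \in msupp a -> w (val m) = w (val n) -> m = n.
  move=> ma na wmn; apply/val_inj/expo_inj; [exact/eqP/(valP m)|exact/eqP/(valP n)|].
  apply/ffunP => v; apply: (weight_inj _ _ wmn) => [u _|u _|]; rewrite ?mem_enum //.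
    exact: expoB.
  exact: expoB.
have coef m : m \in msupp a -> ~ q (val m) -> (kronecker q B a)`_(w (val m)) = a@_m.
  move=> ma qm; rewrite /kronecker /lext coef_sum (big_fsetD1 m) //=.
  rewrite big1_seq => [|n /andP[_]].
    by rewrite addr0 coefZ /kronecker_monomial asboolF // coefXn eqxx mulr1.
  rewrite in_fsetD1 => /andP[nm na]; rewrite coefZ /kronecker_monomial.
  case: asboolP => _; rewrite ?coef0 ?mulr0 // coefXn.
  case: eqP => [/(w_inj _ _ ma na) mn|_]; last by rewrite mulr0.
  by rewrite mn eqxx in nm.
have [c [k [c0 ak]]] : exists c k, c != 0 /\ kronecker q B a = c *: 'X^k.
  have : kronecker q B a %| 'X^(w r).
    rewrite -[X in _ %| X]/('X^(w r)) -(_ : kronecker q B (a * b) = 'X^(w r)).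
      by rewrite kroneckerM dvdp_mulr.
    by rewrite ab kroneckerT /kronecker_monomial asboolF.
  (* Writing [X] as [X - 0] gives a power of a linear factor, whose divisors are known up to a
     nonzero scalar. *)
  rewrite -['X]subr0 => /dvdp_exp_XsubCP[k [_]].
  rewrite subr0 => /eqpP[[c1 c2] /andP[/= c10 c20] e].
  exists (c1^-1 * c2), k; split; first by rewrite mulf_neq0 ?invr_eq0.
  by rewrite -scalerA -e scalerA mulVf // scale1r.
have wk m : a@_m != 0 -> ~ q (val m) -> m \in msupp a /\ w (val m) = k.
  move=> am qm; have ma : m \in msupp a by rewrite -mcoeff_neq0.
  split=> //; move: am; rewrite -coef // ak coefZ coefXn.
  by have [|_] := eqVneq (w (val m)) k; rewrite // mulr0 eqxx.
have [[m [am qm]]|none] := pselect (exists m : finite_elt M, a@_m != 0 /\ ~ q (val m)).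
  exists m; split=> // n an qn; have [ma em] := wk m am qm.
  by have [na en] := wk n an qn; apply: w_inj; rewrite ?en.
(* If [q] contained every monomial of [a], the image of [a] would be [0] instead of [c X^k]. *)
move/eqP: ak; rewrite /kronecker /lext big1_seq.
  by rewrite eq_sym scaler_eq0 (negbTE c0) expf_eq0 polyX_eq0 andbF.
move=> m /andP[_ ma]; rewrite /kronecker_monomial asboolT ?scaler0 //.
by apply: contrapT => qm; apply: none; exists m; rewrite mcoeff_neq0.
Qed.

(* Modulo every prime avoiding [f], a factor [a] of a power of [monomial f] is
   a single monomial, always the same one as [p] is the largest such prime; the
   other monomials of [a] vanish on [D(f)]. *)
Lemma monomial_factor (p : binoid_spec M) (f : M) (a b : A) N :
  ~ p f -> (forall mu, ~ p mu -> exists k lam, mu + lam = f *+ k) ->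
  a * b = monomial K (f *+ N) ->
  exists (c : K) (mu : M), [/\ c != 0, ~ p mu &
    a * monomial K f = c *: monomial K (mu + f)].
Proof.
move=> pf pdiv ab.
have uniq_q (q : binoid_spec M) : ~ q f -> _ :=
  fun qf => monomial_mod_prime (bcompl_muln (k := N) qf) ab.
have [m [am pm m_uniq]] := uniq_q p pf.
exists (a@_m), (val m); split=> //.
have termE (n : finite_elt M) :
    (a@_n *: monomial K (val n)) * monomial K f = a@_n *: monomial K (val n + f).
  by rewrite -(balg_scalerAl a@_n (monomial K (val n))) TD.
rewrite {1}[a]algE mulr_suml (eq_bigr _ (fun n _ => termE n)).
rewrite (big_fsetD1 m) /=; last by rewrite -mcoeff_neq0.
rewrite big1_seq ?addr0 // => n /andP[_].
rewrite in_fsetD1 -mcoeff_neq0 => /andP[nm an].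
rewrite (_ : val n + f = infty) ?T_infty ?scaler0 //.
apply: contrapT => /prime_avoiding[|q]; first exact: simplicial_radical.
move=> /bcompl_prime[qn qf]; have [m' [_ _ m'_uniq]] := uniq_q q qf.
(* [val m] is a summand of a multiple of [f], so it survives modulo [q]; then [n] and [m] must both
   be [m']. *)
have qm : ~ q (val m).
  have [k [lam e]] := pdiv _ pm.
  by have := bcompl_muln (k := k) qf; rewrite -e => /bcompl_prime[].
by move/eqP: nm; apply; rewrite (m'_uniq n) // (m'_uniq m).
Qed.

End MonomialFactor.

(** The constant sheaf is built as a sheaf of monoids, so inverses are supplied pointwise; they are
    again locally constant. *)
Lemma const_section_inv (X : topologicalType) (B : zmodType) (U : opens X)
    (c : const_sheaf X B U) : is_unit c.
Proof.
have lc : locally_modelled (const_model X B) (fun x (hx : in_opens U x) => - sec_val c hx).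
  move=> x hx; have [W [oW Wx WU [b cb]]] := sec_local c hx.
  exists W; split=> //; exists (- b) => y hy Wy.
  by rewrite /= /const_rel (cb y hy Wy).
exists (LocalSection lc); apply: local_section_ext => x hx; exact: addrN.
Qed.

Lemma frac_locally_modelled (X : topologicalType) (A : nmodType)
    (S : X -> submonoid A) (U : opens X) (a f : A)
    (h : forall x, in_opens U x -> S x f) :
  locally_modelled (frac_model S) (fun x hx => frac a (h x hx)).
Proof.
move=> x hx; exists (in_opens U); split=> //; first exact: opens_open.
by exists (a, f) => y hy _; exists (h y hy).
Qed.

(** * Contraction of primes and the map on germs *)

Section Contraction.
Variables (K : fieldType) (M : binoidType).
Local Notation A := (binoid_algebra K M).

Lemma contraction_subproof (P : comb_spec K M) :
  binoid_prime [set mu | prime_set P (monomial K mu)].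
Proof.
have [[P0 PD PM] PT PP] := primeP P; split=> [||a b] /=.
- split=> [|a b] /=; first by rewrite T_infty.
  by rewrite -TD => Pb; exact: PM.
- move=> h; apply: (@prime_proper _ P); rewrite -T0.
  by have : [set mu | prime_set P (monomial K mu)] 0 by rewrite h.
- by rewrite -TD => /PP.
Qed.

(** In the simplicial case a retraction of [i_map], see [contraction_i_map]; germs at [P] are
    compared with binoid germs at this prime. *)
Definition contraction (P : comb_spec K M) : binoid_spec M :=
  BinoidSpec (contraction_subproof P).

Lemma scaler_monomialM (c : K) (mu nu : M) :
  (c *: monomial K mu) * monomial K nu = c *: monomial K (mu + nu).
Proof. by rewrite -(balg_scalerAl c (monomial K mu)) TD. Qed.

Lemma monomial_scalerM (c : K) (mu nu : M) :
  monomial K nu * (c *: monomial K mu) = c *: monomial K (nu + mu).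
Proof. by rewrite (mulrC (monomial K nu)) scaler_monomialM addrC. Qed.

Lemma scaler_monomialMM (c d : K) (mu nu : M) :
  (c *: monomial K mu) * (d *: monomial K nu) = (c * d) *: monomial K (mu + nu).
Proof. by rewrite -(balg_scalerAl c (monomial K mu)) monomial_scalerM scalerA. Qed.

Lemma monomial_cross (c : K) (u mu nu mu' nu' : M) :
  u + (mu + nu') = u + (mu' + nu) ->
  monomial K u * ((c *: monomial K mu) * monomial K nu') =
  monomial K u * ((c *: monomial K mu') * monomial K nu).
Proof.
move=> e; rewrite (scaler_monomialM c mu) (scaler_monomialM c mu').
by rewrite (monomial_scalerM c (mu + _)) (monomial_scalerM c (mu' + _)) e.
Qed.

Lemma monomialMn (mu : M) n : monomial K (mu *+ n) = monomial K mu ^+ n.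
Proof. by elim: n => [|n IH]; rewrite ?mulr0n // mulrS exprS -TD IH. Qed.

Definition scalar (c : units (mulmon K)) : K := of_mulmon (val c).

Lemma scalar_neq0 c : scalar c != 0.
Proof.
have [y /(congr1 (@of_mulmon K)) e] := unitsP c.
have {}e : scalar c * of_mulmon y = 1 := e.
by apply/eqP => c0; move/eqP: e; rewrite c0 mul0r eq_sym oner_eq0.
Qed.

Lemma scalar_inj : injective scalar.
Proof. by move=> [[c] hc] [[d] hd] e; apply: val_inj; congr MulMon. Qed.

Lemma scalar_surj (c : K) : c != 0 -> exists d, scalar d = c.
Proof.
move=> c0; have uc : is_unit (MulMon c).
  by exists (MulMon c^-1); congr MulMon; rewrite mulfV.
by exists (mk_unit uc).
Qed.

(** The formula uses a chosen representative of [e]; [germE] shows that every other fraction gives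
    the same germ. *)
Definition germ (P : comb_spec K M) (e : loc (bcompl (contraction P)))
    (c : units (mulmon K)) : loc (rcompl P) :=
  @frac _ (rcompl P) (MulMon (scalar c *: monomial K (repr e).1))
    (MulMon (monomial K (val (repr e).2))) (denomP (repr e).2).

Lemma germE (P : comb_spec K M) (mu nu : M) (h : bcompl (contraction P) nu)
    (h' : rcompl P (MulMon (monomial K nu))) c :
  germ (frac mu h) c = frac (MulMon (scalar c *: monomial K mu)) h'.
Proof.
have /fracE[u Pu e] := frac_repr (frac mu h); apply/frac_ringE.
exists (monomial K u); first exact: Pu.
exact: monomial_cross e.
Qed.

Lemma germ0 P : germ (0 : loc (bcompl (contraction P))) 0 = 0.
Proof.
rewrite (germE (nu := 0) 0 _ (submon0 (rcompl P))).
by apply/frac_ringE; exists 1; [exact: prime_proper|rewrite T0 scale1r].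
Qed.

Lemma germD P (e e' : loc (bcompl (contraction P))) c c' :
  germ (e + e') (c + c') = germ e c + germ e' c'.
Proof.
have [mu [nu [h ->]]] := frac_surj e; have [mu' [nu' [h' ->]]] := frac_surj e'.
rewrite fracD (germE mu h h) (germE mu' h' h').
have hh : rcompl P (MulMon (monomial K (nu + nu'))) := submonD h h'.
rewrite (germE _ _ hh) fracD; apply/frac_ringE; exists 1; first exact: prime_proper.
congr (1 * (_ * _)); last exact: (TD K nu nu').
exact: esym (scaler_monomialMM _ _ _ _).
Qed.

(** Invertibility makes [mu] a summand of an element outside [p], and the complement of a prime is
    closed under summands. *)
Lemma unit_frac_compl (p : binoid_spec M) (mu nu : M) (h : bcompl p nu) :
  is_unit (frac mu h) -> ~ p mu.
Proof.
move=> [y]; have [a [s [hs ->]]] := frac_surj y.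
rewrite fracD => /fracE[u pu]; rewrite addr0 add0r => e.
have : bcompl p (u + (mu + a)) by rewrite e; do 2! apply: bcomplD => //.
by move=> /bcompl_prime[_ /bcompl_prime[]].
Qed.

(** Equality of the germs puts a difference of two monomial terms into [P], hence into the span of
    [contraction P]. The element [mu + nu'] lies outside that prime, so its coefficient must cancel,
    which forces equal monomials and equal scalars. *)
Lemma germ_inj (P : comb_spec K M) (e e' : loc (bcompl (contraction P))) c c' :
  prime_set P `<=` span_ideal (contraction P) -> is_unit e ->
  germ e c = germ e' c' -> e = e' /\ c = c'.
Proof.
move=> Pspan; have [mu [nu [h ->]]] := frac_surj e.
have [mu' [nu' [h' ->]]] := frac_surj e'; move=> /unit_frac_compl pmu.
rewrite (germE mu h h) (germE mu' h' h') => /frac_ringE[u Pu].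
rewrite !scaler_monomialM => /eqP; rewrite -subr_eq0 -mulrBr => /eqP uP.
have [[P0 _ _] _ PP] := primeP P.
have : prime_set P (u * (scalar c *: monomial K (mu + nu') -
                         scalar c' *: monomial K (mu' + nu))) by rewrite uP.
move=> /PP[//|/Pspan/span_idealP diff].
have pm : ~ contraction P (mu + nu') by exact: bcomplD.
have fin : mu + nu' != infty.
  apply/eqP => e0; apply: pm; rewrite e0; by have [[]] := bprimeP (contraction P).
have := diff (exist _ (mu + nu') fin).
rewrite mcoeffB !mcoeffZ !mcoeffT /= eqxx mulr1.
have [eqm|_] := eqVneq (mu' + nu) (mu + nu'); last first.
  by rewrite mulr0 subr0 scalar_neq0 => /(_ isT)/pm.
rewrite mulr1; have [cc' _|_ /(_ isT)/pm//] := eqVneq (scalar c - scalar c') 0.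
split; last by apply/scalar_inj/eqP; rewrite -subr_eq0; apply/eqP.
by apply/fracE; exists 0; [exact: bcompl0|rewrite eqm].
Qed.

End Contraction.

(** * The embedding of the direct sum into the sheaf of units *)

Section Embedding.
Variables (K : fieldType) (V : finType) (Delta : {set {set V}}).
Local Notation M := (simplicial_binoid Delta).
Local Notation A := (binoid_algebra K M).
Local Notation i_cont := (@i_map_continuous K V Delta).

Lemma contraction_i_map (p : binoid_spec M) : contraction (i_map K p) = p.
Proof.
apply: binoid_spec_ext; apply/predeqP => mu /=.
by apply: span_idealT; have [[]] := bprimeP p.
Qed.

(* Every combinatorial neighbourhood of [P] contains the combinatorial prime
   [K[contraction P]] below it. *)
Lemma i_map_contraction (U : opens (comb_spec K M)) P :
  in_opens U P -> in_opens U (i_map K (contraction P)).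
Proof.
have [I hI ->] := opens_open U => /comb_openP[mu Imu nPmu].
have [[p_infty _] _ _] := bprimeP (contraction P).
by apply/comb_openP; exists mu => // /(span_idealT K mu p_infty).1.
Qed.

Section OnOpen.
Variable U : opens (comb_spec K M).

(** A basic neighbourhood [D(f)] of [contraction P] pulls back to the Zariski open set of primes not
    containing [monomial K f]; near [P], one fraction for [s] and one value of [c] combine into a
    single fraction of the ring. *)
Lemma embed_local (s : binoid_structure_sheaf M (preimage_opens i_cont U))
    (c : const_units K Delta U) :
  locally_modelled (frac_model (@rcompl A))
    (fun P (hP : in_opens (preimage_opens (@to_comb_continuous K M) U) P) =>
       germ (sec_val s (i_map_contraction hP)) (sec_val c hP)).
Proof.
move=> P hP.
have [W [oW WP WU [[mu nu] smn]]] := sec_local s (i_map_contraction hP).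
have [f [pf fW]] := (binoid_openE W).1 oW _ WP.
have [W' [oW' W'P W'U [a ca]]] := sec_local c hP.
exists (W' `&` [set Q | ~ prime_set Q (monomial K f)]); split=> //.
- apply: openI.
    exact: ((continuousP (@to_comb K M)).1 (@to_comb_continuous K M) W' oW').
  by apply/zariski_openE => Q Qf; exists (monomial K f).
- by move=> Q [/W'U].
exists (MulMon (scalar a *: monomial K mu), MulMon (monomial K nu)).
move=> Q hQ [W'Q Qf].
have [h ->] := smn (contraction Q) (i_map_contraction hQ) (fW (contraction Q) Qf).
have -> : sec_val c hQ = a := ca Q hQ W'Q.
by exists h; apply: germE.
Qed.

Definition embed (x : split_sheaf K Delta U) : comb_structure_sheaf K M U :=
  LocalSection (embed_local (val x.1) x.2).

Lemma embed0 : embed 0 = 0.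
Proof. by apply: local_section_ext => P hP; exact: germ0. Qed.

Lemma embedD x y : embed (x + y) = embed x + embed y.
Proof. by apply: local_section_ext => P hP; exact: germD. Qed.

Lemma embed_unit x : is_unit (embed x).
Proof.
have [c' xc'] := const_section_inv x.2.
exists (embed (- x.1, c')); rewrite -embedD -embed0; congr embed.
by case: x xc' => s c /= xc'; congr (_, _); first exact: addrN.
Qed.

Definition units_embed (x : split_sheaf K Delta U) : units_SR K Delta U :=
  mk_unit (embed_unit x).

Lemma units_embed_morphism : nmod_morphism units_embed.
Proof. by split=> [|x y]; apply/val_inj; [exact: embed0|exact: embedD]. Qed.

HB.instance Definition _ := GRing.isNmodMorphism.Build
  (split_sheaf K Delta U) (units_SR K Delta U) units_embed units_embed_morphism.

Definition embedding_app : {additive split_sheaf K Delta U -> units_SR K Delta U} :=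
  units_embed.

End OnOpen.

Lemma embedding_natural (U W : opens (comb_spec K M)) (h : W `<=` U) s :
  embedding_app W (restr (split_sheaf K Delta) h s) =
  restr (units_SR K Delta) h (embedding_app U s).
Proof.
apply/val_inj/local_section_ext => P hP /=.
by rewrite (Prop_irrelevance (h _ _) (i_map_contraction (h P hP))).
Qed.

Definition embedding :
  sheaf_hom_on (punctured_opens K Delta) (split_sheaf K Delta) (units_SR K Delta) :=
  SheafHomOn (sheaf_app := fun U _ => embedding_app U)
    (fun U W _ _ h s => embedding_natural h s).

Lemma embedding_natural_embedding : natural_embedding embedding.
Proof.
move=> U hU s c P hP p hp pP mu nu p_nu P_nu e.
have pE : p = contraction P by apply: binoid_spec_ext; apply/predeqP => x; exact: pP.
subst p; rewrite /= -(Prop_irrelevance hp (i_map_contraction hP)) e.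
exact: germE.
Qed.

(** The points [i_map K p] suffice: they index the germs of [s], and the locally constant [c] takes
    the same value at [P] and at [i_map K (contraction P)], which lies in every neighbourhood of
    [P]. *)
Lemma units_embed_inj U : injective (@units_embed U).
Proof.
move=> [s c] [s' c'] /(congr1 val) e.
have {}e P (hP : in_opens U P) : germ (sec_val (val s) (i_map_contraction hP)) (sec_val c hP) =
                germ (sec_val (val s') (i_map_contraction hP)) (sec_val c' hP).
  exact: (congr1 (fun t : comb_structure_sheaf K M U => sec_val t hP) e).
have inj p (hp : in_opens U (i_map K p)) :
    sec_val (val s) (i_map_contraction hp) = sec_val (val s') (i_map_contraction hp) /\
    sec_val c hp = sec_val c' hp.
  apply: germ_inj (e _ hp); first by rewrite contraction_i_map.
  have [t st] := unitsP s; exists (sec_val t (i_map_contraction hp)).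
  exact: (congr1 (fun t : binoid_structure_sheaf M (preimage_opens i_cont U) =>
    sec_val t (i_map_contraction hp)) st).
congr (_, _).
  apply/val_inj/local_section_ext => p hp.
  (* The membership proof is generalized so that [contraction (i_map K p)] can be rewritten to [p]
     inside the dependent type of the germs. *)
  have := (inj p hp).1; move: (i_map_contraction hp).
  by rewrite contraction_i_map => hp'; rewrite (Prop_irrelevance hp hp').
apply: local_section_ext => P hP.
have const (d : const_units K Delta U) : sec_val d hP = sec_val d (i_map_contraction hP).
  have [W [oW WP WU [a da]]] := sec_local d hP.
  have WiP : W (i_map K (contraction P)).
    exact: (@i_map_contraction (Opens oW)).
  by rewrite (da _ hP WP) (da _ (i_map_contraction hP) WiP).
by rewrite !const; have [] := inj _ (i_map_contraction hP).
Qed.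

(** * Local surjectivity on smallest neighbourhoods *)

Lemma comb_basic_open (f : M) :
  open ([set Q | ~ prime_set Q (monomial K f)] : set (comb_spec K M)).
Proof.
(* The principal ideal of [f]: a prime omits some monomial from it exactly when it omits
   [monomial K f]. *)
exists [set nu | exists lam, nu = lam + f].
  split; first by exists infty; rewrite infty_addm.
  by move=> a _ [lam ->]; exists (a + lam); rewrite addrA.
apply/predeqP => Q; split=> [Qf|/comb_openP[_ [lam ->]] /= nQ Qf].
  by apply/comb_openP; exists f => //; exists 0; rewrite add0r.
by apply: nQ; have [[_ _ QM] _ _] := primeP Q; rewrite -TD; exact: QM.
Qed.

Lemma unit_section_basic_open (p : binoid_spec M) (f : M)
    (W : opens (comb_spec K M)) (t : units_SR K Delta W) :
  (forall Q, in_opens W Q <-> ~ prime_set Q (monomial K f)) ->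
  ~ p f -> (forall mu, ~ p mu -> exists k lam, mu + lam = f *+ k) ->
  exists (c : units (mulmon K)) (mu nu : M), [/\ ~ p mu, ~ p nu &
    forall Q (hQ : in_opens W Q), exists h : rcompl Q (MulMon (monomial K nu)),
      sec_val (val t) hQ = frac (MulMon (scalar c *: monomial K mu)) h].
Proof.
move=> Wf pf pdiv; have [t' tt'] := unitsP t.
have red := @algebra_reduced K V Delta.
have sec := section_basic_open red
  (U := preimage_opens (@to_comb_continuous K M) W) (f := monomial K f).
have [n [a ta]] := sec (val t) Wf; have [m [b t'b]] := sec t' Wf.
have Qpow k (Q : comb_spec K M) :
    in_opens W Q -> rcompl Q (MulMon (monomial K f ^+ k)).
  move=> /Wf Qf; rewrite -monomialMn.
  exact: (bcompl_muln (p := contraction Q)).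
pose F := monomial K f.
(* On [D(f)] the product [a * b] agrees with [F^(n+m)]. With the extra factor [F] the difference
   also lies in the primes containing [F], so reducedness turns the equation into an identity in the
   ring. *)
have ab : a * (b * F) = monomial K (f *+ (n + m).+1).
  rewrite monomialMn exprS [RHS]mulrC mulrA exprD -/F.
  apply/eqP; rewrite -subr_eq0 -mulrBl; apply/eqP/red => Q.
  have [[_ _ QM] _ QP] := primeP Q.
  have [QF|QF] := pselect (prime_set Q F); first exact: QM.
  rewrite mulrC; apply: (QM); have hQ := (Wf Q).2 QF.
  have := congr1 (fun u : comb_structure_sheaf K M W => sec_val u hQ) tt'.
  move=> /= ; rewrite (ta Q hQ (Qpow n Q hQ)) (t'b Q hQ (Qpow m Q hQ)).
  rewrite fracD => /frac_ringE[u Qu e].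
  have {}e : u * (a * b) = u * (F ^+ n * F ^+ m).
    apply: (etrans (congr1 ( *%R u) (esym (mulr1 (a * b))))).
    exact: (etrans e (congr1 ( *%R u) (mul1r (F ^+ n * F ^+ m)))).
  have : prime_set Q (u * (a * b - F ^+ n * F ^+ m)).
    suff -> : u * (a * b - F ^+ n * F ^+ m) = 0 by have [[]] := primeP Q.
    apply: (etrans (mulrBr u (a * b) (F ^+ n * F ^+ m))).
    exact: (etrans (congr1 (fun x => x - _) e) (subrr _)).
  move=> /QP[h|]; first by case: (Qu h).
  exact.
have [c0 [mu [c0N pmu aF]]] := monomial_factor pf pdiv ab.
have [c cE] := scalar_surj c0N.
exists c, mu, (f *+ n); split=> //; first exact: bcompl_muln.
move=> Q hQ; have hn : rcompl Q (MulMon (monomial K (f *+ n))).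
  by rewrite monomialMn; exact: Qpow.
exists hn; rewrite (ta Q hQ (Qpow n Q hQ)); apply/frac_ringE.
(* [a] becomes a scalar multiple of a monomial only after multiplication by [F], so [F] witnesses
   the equality of fractions. *)
exists F; first exact/Wf.
have FE : F * a = F * (scalar c *: monomial K mu).
  by rewrite (monomial_scalerM _ mu f) (mulrC F a) aF cE (addrC f).
rewrite monomialMn.
exact: (etrans (mulrA F a _) (etrans (congr1 ( *%R^~ _) FE) (esym (mulrA F _ _)))).
Qed.

(** A prime avoiding [f] avoids all that [p] avoids, since these elements are summands of multiples
    of [f]. Hence [D(f)] lies in [U], and the fraction [mu / nu] found there is defined and
    invertible on all of it. *)
Lemma embedding_locally_surjective (U : opens (comb_spec K M))
    (t : units_SR K Delta U) P : in_opens U P ->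
  exists (W : opens (comb_spec K M)) (hWU : W `<=` U), in_opens W P /\
  exists s, units_embed s = restr (units_SR K Delta) hWU t.
Proof.
move=> UP; pose p := contraction P; pose f := face_sum p.
have pf : ~ p f := face_sum_compl (p := p).
have pdiv mu : ~ p mu -> exists k lam, mu + lam = f *+ k := @face_sum_multiple _ _ p mu.
pose W := Opens (comb_basic_open f).
have W_sub (q : binoid_spec M) mu : ~ q f -> ~ p mu -> ~ q mu.
  move=> qf /pdiv[k [lam e]].
  by have := bcompl_muln (k := k) qf; rewrite -e => /bcompl_prime[].
have hWU : W `<=` U.
  have [I hI UE] := opens_open U; rewrite UE in UP *.
  move: UP => /comb_openP[mu Imu nP] Q Qf; apply/comb_openP; exists mu => //.
  exact: (W_sub (contraction Q)).
exists W, hWU; split=> //.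
have [c [mu [nu [pmu pnu tE]]]] :=
  unit_section_basic_open (restr (units_SR K Delta) hWU t) (fun Q => iff_refl _) pf pdiv.
have Wi q : in_opens (preimage_opens i_cont W) q -> ~ q f.
  move=> /= nq qf; apply: nq; apply/span_idealT => //.
  by have [[]] := bprimeP q.
have q_nu q (hq : in_opens (preimage_opens i_cont W) q) : bcompl q nu.
  exact: W_sub (Wi q hq) pnu.
have q_mu q (hq : in_opens (preimage_opens i_cont W) q) : bcompl q mu.
  exact: W_sub (Wi q hq) pmu.
pose s0 : binoid_structure_sheaf M (preimage_opens i_cont W) :=
  LocalSection (frac_locally_modelled mu q_nu).
have us0 : is_unit s0.
  exists (LocalSection (frac_locally_modelled nu q_mu)).
  apply: local_section_ext => q hq /=; rewrite fracD; apply/fracE.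
  by exists 0; [exact: bcompl0|rewrite !add0r addr0 addrC].
have lc : locally_modelled (const_model (comb_spec K M) (units (mulmon K)))
    (fun Q (hQ : in_opens W Q) => c).
  move=> Q hQ; exists (in_opens W); split=> //; first exact: opens_open.
  by exists c.
exists (mk_unit us0, LocalSection lc).
apply/val_inj/local_section_ext => Q hQ.
have [h ->] := tE Q hQ; exact: germE.
Qed.

End Embedding.

Theorem theorem4p19 (K : fieldType) (V : finType) (Delta : {set {set V}})
    (hDelta : simplicial_complex Delta) :
  exists phi : sheaf_hom_on (punctured_opens K Delta)
                 (dsum_sheaf
                    (pushforward (@i_map_continuous K V Delta)
                       (units_sheaf
                          (binoid_structure_sheaf (simplicial_binoid Delta))))
                    (const_sheaf (comb_spec K (simplicial_binoid Delta))
                       (units (mulmon K))))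
                 (units_sheaf
                    (comb_structure_sheaf K (simplicial_binoid Delta))),
    is_sheaf_iso phi /\ natural_embedding phi.
Proof.
exists (embedding K Delta); split; last exact: embedding_natural_embedding.
apply: sheaf_iso_local => [U hU|U hU t P]; first exact: units_embed_inj.
exact: embedding_locally_surjective.
Qed.
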